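(* Let $\tau$ be a Hausdorff locally solid topology on an Archimedean vector lattice $X$, and let $(\widehat X,\widehat\tau)$ be the topological completion of $(X,\tau)$. The following are equivalent: (i) $u\tau$ is locally bounded; (ii) $u\tau$ has an order bounded neighbourhood of zero; (iii) $\tau$ has an order bounded neighbourhood of zero; (iv) $\widehat X$ has a strong unit and $\tau$ is metrizable; (v) $\widehat\tau$ coincides with the $\|\cdot\|_u$-topology, where $u$ is a strong unit of $\widehat X$, and $(\widehat X,\|\cdot\|_u)$ is a Banach lattice which is lattice isometric to a $C(K)$-space; (vi) $u\widehat\tau$ is locally bounded. In this case, $\tau=u\tau$ and $\widehat\tau=u\widehat\tau$.
   Context: All vector lattices are assumed Archimedean. A linear topology on a vector lattice is locally solid if it has a base at zero consisting of solid sets. If $\tau$ is locally solid on $X$ with a base at zero $\{U_i\}$ of solid sets, the unbounded $\tau$-topology $u\tau$ is the locally solid topology on $X$ with base at zero consisting of the sets $U_{i,v}=\{x\in X:\ |x|\wedge v\in U_i\}$, over all $i$ and all $v\in X_+$. A subset $S$ of a topological vector space is bounded if for each neighbourhood $U$ of zero there is $\lambda>0$ with $\lambda S\subseteq U$; a linear topology is locally bounded if it has a bounded neighbourhood of zero. A set is order bounded if it is contained in an order interval. A topology is metrizable if it is the metric topology of some metric. A positive vector $u$ of a vector lattice $Y$ is a strong unit if the order ideal it generates is $Y$; in this case $\|x\|_u:=\inf\{\lambda\ge 0:\ |x|\le\lambda u\}$ is a lattice norm on $Y$. A $C(K)$-space is the space of continuous real functions on a compact Hausdorff space $K$ with the supremum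 norm and pointwise order. $(\widehat X,\widehat\tau)$ is the topological (vector space) completion of $(X,\tau)$, ordered by the cone that is the $\widehat\tau$-closure of $X_+$ in $\widehat X$; with it $(\widehat X,\widehat\tau)$ is a Hausdorff locally solid vector lattice containing $X$ as a $\widehat\tau$-dense vector sublattice. *)

(* Defs.v *)
From HB Require Import structures.
From mathcomp Require Import all_boot all_order all_algebra.
From mathcomp Require Import all_classical all_reals all_analysis.

Set Implicit Arguments.
Unset Strict Implicit.
Unset Printing Implicit Defensive.

Import Order.TTheory GRing.Theory Num.Theory.
Import numFieldNormedType.Exports.

Local Open Scope classical_set_scope.
Local Open Scope ring_scope.

(* The structure carries its own suprema and infima instead of inheriting from
   [Order.Lattice]: realDomainType is already a join of [Order.Lattice] and
   [GRing.Zmodule], so Hierarchy Builder admits no independent second one. *)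
HB.mixin Record Lmodule_isVectorLattice (R : realType) X
    & GRing.Lmodule R X & Order.POrder ring_display X := {
  vsup : X -> X -> X ;
  vinf : X -> X -> X ;
  vsup_le : forall x y z : X, (vsup x y <= z) = (x <= z) && (y <= z) ;
  le_vinf : forall x y z : X, (z <= vinf x y) = (z <= x) && (z <= y) ;
  vl_leD2r : forall z x y : X, x <= y -> x + z <= y + z ;
  vl_scale_ge0 : forall (a : R) (x : X), 0 <= a -> 0 <= x -> 0 <= a *: x
}.

#[short(type="vectorLatticeType")]
HB.structure Definition VectorLattice (R : realType) :=
  {X of GRing.Lmodule R X & Order.POrder ring_display X
      & Lmodule_isVectorLattice R X}.

Definition vabs (R : realType) (X : vectorLatticeType R) (x : X) : X :=
  vsup x (- x).

Definition archimedean (R : realType) (X : vectorLatticeType R) : Prop :=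
  forall x y : X, 0 <= x -> (forall n : nat, x *+ n <= y) -> x = 0.

Definition solid (R : realType) (X : vectorLatticeType R) (S : set X) : Prop :=
  forall x y : X, S y -> vabs x <= vabs y -> S x.

HB.mixin Record isLocallySolid (R : realType) X
    & VectorLattice R X & TopologicalLmodule R X := {
  locally_solid : forall U : set X, nbhs (0 : X) U ->
    exists V : set X, [/\ nbhs (0 : X) V, solid V & V `<=` U]
}.

#[short(type="locallySolidType")]
HB.structure Definition LocallySolid (R : realType) :=
  {X of VectorLattice R X & TopologicalLmodule R X & isLocallySolid R X}.

Section VectorLatticeTheory.
Variables (R : realType) (X : vectorLatticeType R).
Implicit Types (x y z v : X) (a : R).

Lemma vsup_lel x y : x <= vsup x y.
Proof. by have := vsup_le x y (vsup x y); rewrite lexx => /esym/andP[]. Qed.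

Lemma vsup_ler x y : y <= vsup x y.
Proof. by have := vsup_le x y (vsup x y); rewrite lexx => /esym/andP[]. Qed.

Lemma vinf_lel x y : vinf x y <= x.
Proof. by have := le_vinf x y (vinf x y); rewrite lexx => /esym/andP[]. Qed.

Lemma vinf_ler x y : vinf x y <= y.
Proof. by have := le_vinf x y (vinf x y); rewrite lexx => /esym/andP[]. Qed.

Lemma vinf_le2 x y z v : x <= z -> y <= v -> vinf x y <= vinf z v.
Proof.
move=> xz yv; rewrite le_vinf.
by rewrite (le_trans (vinf_lel _ _) xz) (le_trans (vinf_ler _ _) yv).
Qed.

Lemma vl_subr_ge0 x y : (0 <= y - x) = (x <= y).
Proof.
apply/idP/idP => h.
  by have := vl_leD2r x _ _ h; rewrite add0r subrK.
by have := vl_leD2r (- x) _ _ h; rewrite subrr.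
Qed.

Lemma vl_leD x y z v : x <= y -> z <= v -> x + z <= y + v.
Proof.
move=> xy zv; apply: le_trans (vl_leD2r z _ _ xy) _.
by rewrite ![y + _]addrC; exact: vl_leD2r.
Qed.

Lemma vl_leBD x y z : (x - y <= z) = (x <= z + y).
Proof.
by rewrite -(vl_subr_ge0 (x - y)) -(vl_subr_ge0 x) opprB addrA.
Qed.

Lemma vl_addr_ge0 x y : 0 <= x -> 0 <= y -> 0 <= x + y.
Proof. by move=> x0 y0; have := vl_leD x0 y0; rewrite addr0. Qed.

Lemma vl_leZ a x y : 0 <= a -> x <= y -> a *: x <= a *: y.
Proof.
by move=> a0 xy; rewrite -vl_subr_ge0 -scalerBr vl_scale_ge0// vl_subr_ge0.
Qed.

Lemma vl_leZ2 a (b : R) x : a <= b -> 0 <= x -> a *: x <= b *: x.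
Proof.
by move=> ab x0; rewrite -vl_subr_ge0 -scalerBl vl_scale_ge0// subr_ge0.
Qed.

Lemma vabs_ge0 x : 0 <= vabs x.
Proof.
have h : 0 <= vabs x + vabs x.
  by rewrite -(subrr x); apply: vl_leD; [exact: vsup_lel|exact: vsup_ler].
have e : 2^-1 *: (vabs x + vabs x) = vabs x.
  by rewrite scalerDr -scalerDl -[2^-1]mul1r -splitr scale1r.
by rewrite -e vl_scale_ge0// invr_ge0.
Qed.

Lemma vabs_le x y : (vabs x <= y) = (x <= y) && (- x <= y).
Proof. exact: vsup_le. Qed.

Lemma vabs_id x : 0 <= x -> vabs x = x.
Proof.
move=> x0; apply: le_anti; rewrite vsup_lel andbT vabs_le lexx/=.
by rewrite -[- x]add0r vl_leBD vl_addr_ge0.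
Qed.

Lemma vabsN x : vabs (- x) = vabs x.
Proof. by apply: le_anti; rewrite !vabs_le !opprK /vabs opprK !vsup_lel !vsup_ler. Qed.

Lemma vabsD x y : vabs (x + y) <= vabs x + vabs y.
Proof.
by rewrite vabs_le opprD !vl_leD ?vsup_lel ?vsup_ler.
Qed.

Lemma vabsZ_le a x : vabs (a *: x) <= `|a| *: vabs x.
Proof.
wlog a0 : a x / 0 <= a => [hw|].
  have [/hw //|/ltW a0] := leP 0 a.
  have := hw (- a) (- x); rewrite normrN scaleNr scalerN opprK vabsN.
  by apply; rewrite oppr_ge0.
by rewrite ger0_norm// vabs_le -scalerN !vl_leZ ?vsup_lel ?vsup_ler.
Qed.

Lemma vinf_ge0 x y : 0 <= x -> 0 <= y -> 0 <= vinf x y.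
Proof. by move=> x0 y0; rewrite le_vinf x0. Qed.

Lemma vinfD_le x y v : 0 <= x -> 0 <= y -> 0 <= v ->
  vinf (x + y) v <= vinf x v + vinf y v.
Proof.
move=> x0 y0 v0; set w := vinf (x + y) v.
have wv : w <= v by exact: vinf_ler.
have subv z : 0 <= z -> w - z <= v.
  by move=> z0; rewrite vl_leBD (le_trans wv)// addrC -vl_leBD subrr.
rewrite -vl_leBD le_vinf vl_leBD [x + _]addrC -vl_leBD le_vinf.
by rewrite !subv ?vinf_ge0// vl_leBD [y + _]addrC vinf_lel.
Qed.

Lemma vinfZ_le a x v : 1 <= a -> 0 <= v -> vinf (a *: x) v <= a *: vinf x v.
Proof.
move=> a1 v0; have a0 : 0 < a by exact: lt_le_trans a1.
rewrite -[leLHS]scale1r -(mulfV (lt0r_neq0 a0)) -scalerA.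
apply: vl_leZ; first exact: ltW.
rewrite le_vinf; apply/andP; split.
  rewrite -[leRHS]scale1r -(mulVf (lt0r_neq0 a0)) -scalerA.
  by rewrite vl_leZ ?invr_ge0 ?(ltW a0)// vinf_lel.
apply: (@le_trans _ _ (a^-1 *: v)).
  by rewrite vl_leZ ?invr_ge0 ?(ltW a0)// vinf_ler.
by rewrite -[leRHS]scale1r vl_leZ2// invf_le1.
Qed.

Lemma vinf_le2l x y v : x <= y -> vinf x v <= vinf y v.
Proof. by move=> xy; exact: vinf_le2. Qed.

Lemma solid_ge0 (S : set X) x y : solid S -> S y -> 0 <= x -> x <= y -> S x.
Proof.
move=> sS Sy x0 xy; apply: sS Sy _.
by rewrite !vabs_id// (le_trans x0).
Qed.

End VectorLatticeTheory.

Definition unbounded (R : realType) (X : locallySolidType R) : Type := X.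

Section UnboundedTopology.
Variables (R : realType) (X : locallySolidType R).
Local Notation uX := (unbounded X).

HB.instance Definition _ := VectorLattice.on uX.

(* The translates of the sets U_{i,v}.  All solid neighbourhoods of zero are
   used; any base of solid sets generates the same filters. *)
Definition unbounded_nbhs (x : uX) : set_system uX :=
  [set A | exists (U : set X) (v : X), [/\ nbhs (0 : X) U, solid U, 0 <= v &
    [set y : X | U (vinf (vabs (y - x)) v)] `<=` A]].

Lemma solid_half (U : set X) : nbhs (0 : X) U -> exists W : set X,
  [/\ nbhs (0 : X) W, solid W & forall x y, W x -> W y -> U (x + y)].
Proof.
move=> U0; have := @add_continuous X (0, 0) U; rewrite /= addr0 => /(_ U0).
case=> -[A B] /= [A0 B0] AB.
have [W [W0 sW WAB]] := locally_solid _ (filterI A0 B0).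
exists W; split=> // x y /WAB[Ax _] /WAB[_ By].
exact: (AB (x, y)).
Qed.

Lemma unbounded_nbhs_filter (x : uX) : ProperFilter (unbounded_nbhs x).
Proof.
split.
  move=> [U [v [U0 sU v0 sub]]]; apply: (sub x) => /=.
  rewrite subrr.
  apply: (solid_ge0 sU (nbhs_singleton U0)).
    by rewrite vinf_ge0 ?vabs_ge0.
  by rewrite vabs_id//; exact: vinf_lel.
split.
- have [U [U0 sU _]] := locally_solid _ (filterT : nbhs (0 : X) setT).
  by exists U, 0; split.
- move=> A B [U [v [U0 sU v0 UA]]] [W [w [W0 sW w0 WB]]].
  exists (U `&` W), (v + w); split.
  + exact: filterI.
  + by move=> y z [Uz Wz] yz; split; [exact: sU yz|exact: sW yz].
  + exact: vl_addr_ge0.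
  + move=> y /= [Uy Wy]; split; [apply: UA|apply: WB] => /=.
      apply: solid_ge0 Uy _ _; [by []|by rewrite vinf_ge0 ?vabs_ge0|].
      by apply: vinf_le2 => //; rewrite addrC -vl_leBD subrr.
    apply: solid_ge0 Wy _ _; [by []|by rewrite vinf_ge0 ?vabs_ge0|].
    by apply: vinf_le2 => //; rewrite -vl_leBD subrr.
- move=> A B AB [U [v [U0 sU v0 UA]]]; exists U, v; split=> //.
  exact: subset_trans AB.
Qed.

Lemma unbounded_nbhs_singleton (x : uX) (A : set uX) :
  unbounded_nbhs x A -> A x.
Proof.
move=> [U [v [U0 sU v0 sub]]]; apply: sub => /=; rewrite subrr.
apply: (solid_ge0 sU (nbhs_singleton U0)).
  by rewrite vinf_ge0 ?vabs_ge0.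
by rewrite vabs_id//; exact: vinf_lel.
Qed.

Lemma vinf_half (U W : set X) (v x y z : X) : solid U -> solid W -> 0 <= v ->
    (forall x y, W x -> W y -> U (x + y)) ->
    vabs x <= vabs y + vabs z ->
    W (vinf (vabs y) v) -> W (vinf (vabs z) v) -> U (vinf (vabs x) v).
Proof.
move=> sU sW v0 WU xyz Wy Wz; apply: (solid_ge0 sU (WU _ _ Wy Wz)).
  by rewrite vinf_ge0 ?vabs_ge0.
by apply: le_trans (vinf_le2l _ xyz) _; rewrite vinfD_le ?vabs_ge0.
Qed.

Lemma unbounded_nbhs_nbhs (x : uX) (A : set uX) :
  unbounded_nbhs x A -> unbounded_nbhs x (unbounded_nbhs^~ A).
Proof.
move=> [U [v [U0 sU v0 UA]]]; have [W [W0 sW WU]] := solid_half U0.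
exists W, v; split=> // y /= Wy; exists W, v; split=> // z /= Wz.
apply: UA => /=; apply: vinf_half Wz Wy => //.
by rewrite -(subrK y z) -[_ - x]addrA addrK; exact: vabsD.
Qed.

HB.instance Definition _ := hasNbhs.Build uX unbounded_nbhs.

HB.instance Definition _ := Nbhs_isNbhsTopological.Build uX
  unbounded_nbhs_filter unbounded_nbhs_singleton unbounded_nbhs_nbhs.

Lemma unbounded_add_continuous : continuous (fun x : uX * uX => x.1 + x.2).
Proof.
move=> [x y] A /= [U [v [U0 sU v0 UA]]].
have [W [W0 sW WU]] := solid_half U0.
exists ([set z | W (vinf (vabs (z - x)) v)],
        [set z | W (vinf (vabs (z - y)) v)]) => /=.
  by split; exists W, v; split.
move=> [x' y'] /= [Wx Wy]; apply: UA => /=; apply: vinf_half Wx Wy => //.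
by rewrite opprD addrACA; exact: vabsD.
Qed.

Lemma unbounded_scale_continuous :
  continuous (fun z : R^o * uX => z.1 *: z.2).
Proof.
move=> [a x] A /= [U [v [U0 sU v0 UA]]].
have [W [W0 sW WU]] := solid_half U0.
pose b : R := `|a| + 1.
have b1 : 1 <= b by rewrite lerDr.
have [V [V0 sV VW]] : exists V : set X,
    [/\ nbhs (0 : X) V, solid V & forall y, V y -> W (b *: y)].
  have := @scale_continuous R X (b, 0) W; rewrite /= scaler0 => /(_ W0).
  case=> -[B C] /= [B0 C0] BC; have [V [V0 sV VC]] := locally_solid _ C0.
  exists V; split=> // y /VC Cy; apply: (BC (b, y)); split => //=.
  exact: nbhs_singleton B0.
have W1 : \forall c \near (a : R^o), W ((c - a) *: x : X).
  have := @scale_continuous R X (0, x : X) W; rewrite /= scale0r => /(_ W0).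
  case=> -[B C] /= [B0 C0] BC.
  have /nbhs_ballP[e /= e0 eB] := B0.
  apply/nbhs_ballP; exists e => //= c ace; apply: (BC (_, _)); split => /=.
    by apply: eB; move: ace; rewrite -!ball_normE/= sub0r normrN distrC.
  exact: nbhs_singleton C0.
have B1 : \forall c \near (a : R^o), `|c| <= b.
  apply/nbhs_ballP; exists 1 => //= c; rewrite -ball_normE/= => ac1.
  rewrite -(subrK a c) (le_trans (ler_normD _ _))// addrC lerD2l.
  by rewrite distrC ltW.
exists ([set c | W ((c - a) *: x : X) /\ `|c| <= b],
        [set z : uX | V (vinf (vabs (z - x)) v)]) => /=.
  by split; [exact: filterI|exists V, v; split].
move=> [c z] /= [[Wc cb] Vz]; apply: UA => /=.
apply: (@vinf_half U W v _ (c *: (z - x)) ((c - a) *: x)) => //.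
- apply: le_trans (vabsD _ _).
  by rewrite scalerBr scalerBl addrA subrK.
- apply: (solid_ge0 sW (VW _ Vz)); first by rewrite vinf_ge0 ?vabs_ge0.
  apply: le_trans (vinfZ_le _ b1 v0); apply: vinf_le2l.
  by apply: le_trans (vabsZ_le _ _) _; rewrite vl_leZ2 ?vabs_ge0.
- apply: sW Wc _; rewrite vabs_id ?vinf_ge0 ?vabs_ge0//; exact: vinf_lel.
Qed.

HB.instance Definition _ :=
  PreTopologicalNmodule_isTopologicalNmodule.Build uX unbounded_add_continuous.

HB.instance Definition _ := TopologicalNmodule_isTopologicalLmodule.Build R uX
  unbounded_scale_continuous.

Lemma unbounded_locally_solid (A : set uX) : nbhs (0 : uX) A ->
  exists V : set uX, [/\ nbhs (0 : uX) V, solid V & V `<=` A].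
Proof.
move=> [U [v [U0 sU v0 UA]]].
exists [set y : X | U (vinf (vabs y) v)]; split.
- by exists U, v; split=> // y /=; rewrite subr0.
- move=> x y /= Uy xy; apply: (solid_ge0 sU Uy).
    by rewrite vinf_ge0 ?vabs_ge0.
  exact: vinf_le2l.
- by move=> y /= Uy; apply: UA; rewrite /= subr0.
Qed.

HB.instance Definition _ := isLocallySolid.Build R uX unbounded_locally_solid.

End UnboundedTopology.

Definition tvs_bounded (R : realType) (X : topologicalLmodType R)
    (S : set X) : Prop :=
  forall U : set X, nbhs (0 : X) U ->
    exists2 l : R, 0 < l & [set l *: x | x in S] `<=` U.

Definition locally_bounded (R : realType) (X : topologicalLmodType R) : Prop :=
  exists2 U : set X, nbhs (0 : X) U & tvs_bounded U.

Definition order_bounded (R : realType) (X : vectorLatticeType R)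
    (S : set X) : Prop :=
  exists a b : X, S `<=` [set x | a <= x <= b].

Definition has_order_bounded_nbhs (R : realType)
    (X : locallySolidType R) : Prop :=
  exists2 U : set X, nbhs (0 : X) U & order_bounded U.

Definition metrizable (R : realType) (T : topologicalType) : Prop :=
  exists d : T -> T -> R,
    [/\ forall x y, 0 <= d x y /\ (d x y = 0 <-> x = y),
        forall x y, d x y = d y x,
        forall x y z, d x z <= d x y + d y z &
        forall x : T, nbhs x = nbhs_ball_ (fun y e => [set z | d y z < e]) x].

Definition order_ideal (R : realType) (X : vectorLatticeType R)
    (I : set X) : Prop :=
  [/\ I 0, forall (a : R) (x y : X), I x -> I y -> I (a *: x + y) & solid I].

(* [smallest order_ideal [set u]] is the order ideal generated by [u]. *)
Definition strong_unit (R : realType) (X : vectorLatticeType R)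
    (u : X) : Prop :=
  0 <= u /\ smallest (@order_ideal R X) [set u] = [set: X].

Definition unit_norm (R : realType) (X : vectorLatticeType R) (u x : X) : R :=
  inf [set l : R | 0 <= l /\ vabs x <= l *: u].

Definition lattice_norm (R : realType) (X : vectorLatticeType R)
    (N : X -> R) : Prop :=
  [/\ forall x, N x = 0 -> x = 0,
      forall (a : R) x, N (a *: x) = `|a| * N x,
      forall x y, N (x + y) <= N x + N y &
      forall x y, vabs x <= vabs y -> N x <= N y].

Definition norm_complete (R : realType) (X : vectorLatticeType R)
    (N : X -> R) : Prop :=
  forall f : nat -> X,
    (forall e : R, 0 < e -> exists n0 : nat, forall m n : nat,
        (n0 <= m)%N -> (n0 <= n)%N -> N (f m - f n) < e) ->
    exists x : X, (fun n => N (f n - x)) @ \oo --> (0 : R).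

Definition banach_lattice (R : realType) (X : vectorLatticeType R)
    (N : X -> R) : Prop :=
  lattice_norm N /\ norm_complete N.

(* [K] may be empty, in which case the supremum is that of the empty set,
   namely 0, and C(K) = {0}. *)
Definition sup_norm (R : realType) (K : topologicalType)
    (f : continuousType K R) : R :=
  sup [set `|f k| | k in [set: K]].

Definition lattice_isometry_CK (R : realType) (X : vectorLatticeType R)
    (N : X -> R) (K : topologicalType) (T : X -> continuousType K R) : Prop :=
  [/\ bijective T,
      forall (a : R) (x y : X) (k : K), T (a *: x + y) k = a * T x k + T y k,
      forall (x y : X) (k : K), T (vsup x y) k = Num.max (T x k) (T y k),
      forall (x y : X) (k : K), T (vinf x y) k = Num.min (T x k) (T y k) &
      forall x : X, sup_norm (T x) = N x].

Definition lattice_isometric_to_CK (R : realType) (X : vectorLatticeType R)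
    (N : X -> R) : Prop :=
  exists (K : topologicalType) (T : X -> continuousType K R),
    [/\ compact [set: K], hausdorff_space K & lattice_isometry_CK N T].

Definition tvs_cauchy (R : realType) (X : topologicalLmodType R)
    (F : set_system X) : Prop :=
  forall U : set X, nbhs (0 : X) U ->
    exists2 A : set X, F A & forall x y : X, A x -> A y -> U (x - y).

Definition tvs_complete (R : realType) (X : topologicalLmodType R) : Prop :=
  forall F : set_system X, ProperFilter F -> tvs_cauchy F ->
    exists x : X, F --> x.

(* The topological completion, determined up to a unique isomorphism that
   fixes the points of [X]. *)
Record is_completion (R : realType) (X Xh : locallySolidType R)
    (i : {linear X -> Xh}) : Prop := {
  completion_hausdorff : hausdorff_space Xh ;
  completion_complete : tvs_complete Xh ;
  completion_injective : injective i ;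
  completion_nbhs : forall x : X,
    nbhs x = filter_from (nbhs (i x)) (fun B : set Xh => i @^-1` B) ;
  completion_dense : dense (range i) ;
  completion_cone :
    [set z : Xh | 0 <= z] = closure (i @` [set x : X | 0 <= x]) ;
  completion_sup : forall x y : X, i (vsup x y) = vsup (i x) (i y) ;
  completion_inf : forall x y : X, i (vinf x y) = vinf (i x) (i y)
}.

(* Main.v *)
Require Import Defs.
From HB Require Import structures.
From mathcomp Require Import all_boot all_order all_algebra.
From mathcomp Require Import all_classical all_reals all_analysis.

(** Every condition says that some interval [[-w, w]] is a neighbourhood of
    zero, for [X] or for its completion.

    A neighbourhood that is bounded for the unbounded topology lies in such an
    interval: if [x] is outside [[-v, v]], then truncation at [v] keeps all
    large multiples of the positive part of [|x| - v] below [|x|], so a basic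
    neighbourhood defined with [v] that contains [x] also contains a half-line
    ([locally_bounded_unbounded_interval]). Conversely, let [[-w, w]] be a
    neighbourhood of zero. Then [w] is a strong unit, and a positive [y] whose
    infimum with [w] is below [l w], where [l < 1], is itself below [l w]
    ([vinf_unit_le]). Thus truncation at [w] has no effect near zero, the two
    topologies coincide ([nbhs_interval_unbounded]), and [[-w, w]] is bounded.

    Closed intervals of the completion are the passage from [X] upwards
    ([completion_nbhs_interval]), and density is the passage back
    ([completion_nbhs_interval_inv]). If the completion has a strong unit [u]
    and [X] is metrizable, then [[-u, u]] is a neighbourhood of zero of the
    completion, since otherwise there would be a convergent series of positive
    vectors whose sum is below no multiple of [u]
    ([strong_unit_nbhs_interval]). The multiples of [[-u, u]] are then a base at
    zero, so the topology is that of the norm of [u], and the norm is complete.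

    The isometry with a space C(K) is Kakutani's theorem
    ([unit_norm_isometric_CK]). The compact space K consists of the lattice
    homomorphisms into the scalars that map [u] to 1, with pointwise
    convergence. They are obtained as the minimal elements among the
    sup-preserving sublinear functionals, which correspond to the closed
    subsets of K ([unital_hom_below]); a suitable start of the descent gives a
    homomorphism that attains the norm of a given vector. Surjectivity is the
    lattice form of the Stone-Weierstrass theorem ([spectrum_dense]). *)

Set Implicit Arguments.
Unset Strict Implicit.
Unset Printing Implicit Defensive.

Import Order.TTheory GRing.Theory Num.Theory.
Import numFieldNormedType.Exports.

Local Open Scope classical_set_scope.
Local Open Scope ring_scope.

(** * Truncation in a vector lattice *)

Section VectorLatticeArithmetic.
Variables (R : realType) (X : vectorLatticeType R).
Implicit Types (x y z u v : X) (l : R).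

Lemma vl_le_subr x y z : (x <= y - z) = (x + z <= y).
Proof. by rewrite -vl_subr_ge0 -[in RHS]vl_subr_ge0 opprD addrA addrAC. Qed.

Lemma vl_oppr_le x y : (- x <= - y) = (y <= x).
Proof. by rewrite -(vl_subr_ge0 (- x)) opprK addrC vl_subr_ge0. Qed.

Lemma vl_oppr_le0 x : (- x <= 0) = (0 <= x).
Proof. by rewrite -{1}oppr0 vl_oppr_le. Qed.

Lemma vsupC x y : vsup x y = vsup y x.
Proof. by apply: le_anti; rewrite !vsup_le !vsup_lel !vsup_ler. Qed.

Lemma vinfC x y : vinf x y = vinf y x.
Proof. by apply: le_anti; rewrite !le_vinf !vinf_lel !vinf_ler. Qed.

Lemma vinf_vsup x y : vinf x y = - vsup (- x) (- y).
Proof.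
apply: le_anti; rewrite le_vinf -vl_oppr_le opprK vsup_le !vl_oppr_le.
rewrite vinf_lel vinf_ler /= -(vl_oppr_le x) -(vl_oppr_le y) opprK.
by rewrite vsup_lel vsup_ler.
Qed.

Lemma vsup_idr x y : (vsup x y == y) = (x <= y).
Proof.
apply/eqP/idP => [<-|xy]; first exact: vsup_lel.
by apply: le_anti; rewrite vsup_le xy lexx vsup_ler.
Qed.

Lemma vabs_le0 x : vabs x <= 0 -> x = 0.
Proof.
by rewrite vabs_le vl_oppr_le0 => xs; exact: le_anti.
Qed.

Lemma vabs0 : vabs (0 : X) = 0. Proof. exact: vabs_id. Qed.

Lemma vl_scale_le l x y : 0 < l -> (l *: x <= y) = (x <= l^-1 *: y).
Proof.
move=> l0; have ln0 := lt0r_neq0 l0.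
apply/idP/idP => h.
  by rewrite -[leLHS](scalerK ln0) vl_leZ// invr_ge0 ltW.
by rewrite -[leRHS](scalerKV ln0) vl_leZ// ltW.
Qed.

Lemma vabsZ l x : vabs (l *: x) = `|l| *: vabs x.
Proof.
apply: le_anti; rewrite vabsZ_le /=.
have [->|l0] := eqVneq l 0; first by rewrite normr0 scale0r vabs_ge0.
rewrite vl_scale_le ?normr_gt0// -normfV -{1}(scalerK l0 x).
exact: vabsZ_le.
Qed.

Lemma pos_part_disjoint x : vinf (vsup x 0) (vsup (- x) 0) <= 0.
Proof.
set w := vinf _ _.
have h : vsup x 0 <= vsup x 0 - w.
  rewrite vsup_le !vl_le_subr add0r vinf_lel andbT addrC -vl_le_subr.
  apply: le_trans (vinf_ler _ _) _.
  by rewrite vsup_le vl_subr_ge0 vsup_lel andbT vl_le_subr addNr vsup_ler.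
by move: h; rewrite vl_le_subr addrC -vl_le_subr subrr.
Qed.

(** In a lattice of functions, [v <= x] holds wherever the positive part of
    [x - v] is non-zero, so after truncation by [v] every multiple of this
    positive part disappears below [x]. The proof replaces points by the
    disjointness of the positive parts of [x - v] and of [v - x]. *)
Lemma vinf_excess_le l x v : 1 <= l -> 0 <= x -> 0 <= v ->
  vinf (l *: vsup (x - v) 0) v <= x.
Proof.
move=> l1 x0 v0; set y := vsup _ _; set z := vinf _ _.
have l0 : 0 <= l by exact: le_trans l1.
have y0 : 0 <= y by exact: vsup_ler.
have zx : z - x <= vinf (l *: y) (vsup (v - x) 0).
  rewrite le_vinf vl_leBD; apply/andP; split.
    apply: le_trans (vinf_lel _ _) _.
    by rewrite -{1}[l *: y]addr0 vl_leD.
  apply: le_trans (vsup_lel _ _); apply: vl_leD2r; exact: vinf_ler.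
have : z - x <= 0.
  apply: le_trans zx _; apply: le_trans (vinfZ_le _ l1 (vsup_ler _ _)) _.
  rewrite -[leRHS](scaler0 X l) vl_leZ// -(opprB x v); exact: pos_part_disjoint.
by rewrite vl_leBD add0r.
Qed.

(** By distributivity the left-hand side is the positive part of [vinf x y].
    Adding [vinf x 0] to both sides, which turns the positive part of [x]
    into [x], gives a proof without distributivity. *)
Lemma vinf_pos_part_le0 x y : 0 <= y -> vinf x y <= 0 -> vinf (vsup x 0) y <= 0.
Proof.
move=> y0 xy0; set p := vinf _ _.
have h : p + vinf x 0 <= vinf x 0.
  apply: (@le_trans _ _ (vinf x y)); last by rewrite le_vinf xy0 vinf_lel.
  rewrite le_vinf; apply/andP; split; last first.
    by rewrite -[leRHS]addr0 vl_leD// ?vinf_ler.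
  rewrite [vinf x 0]vinf_vsup oppr0 -vl_le_subr opprK.
  apply: le_trans (vinf_lel _ _) _; rewrite vsup_le.
  rewrite -{1}[x]addr0 vl_leD ?lexx ?vsup_ler//=.
  by rewrite -(subrr x) vl_leD ?vsup_lel.
by move: h; rewrite -vl_le_subr subrr.
Qed.

(** The positive part [z] of [y - l *: u] is disjoint from [(1 - l) *: u]. As
    [z] lies below some multiple [n] of this vector, it lies below [n] times
    their infimum, which is zero. *)
Lemma vinf_unit_le l u y : 0 <= u -> 0 < l < 1 ->
  (exists k : R, y <= k *: u) -> vinf y u <= l *: u -> y <= l *: u.
Proof.
move=> u0 /andP[l0 l1] [k yk] yul.
pose m := 1 - l; have m0 : 0 < m by rewrite subr_gt0.
have mu0 : 0 <= m *: u by rewrite vl_scale_ge0// ltW.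
pose z := vsup (y - l *: u) 0; have z0 : 0 <= z by exact: vsup_ler.
have zd : vinf z (m *: u) <= 0.
  apply: vinf_pos_part_le0 => //.
  rewrite -(subrr (l *: u)) vl_le_subr; apply: le_trans yul.
  rewrite le_vinf -!vl_le_subr vinf_lel/=.
  have -> : u - l *: u = m *: u by rewrite scalerBl scale1r.
  exact: vinf_ler.
(* [vinfZ_le] requires a factor that is at least one. *)
pose n := Num.max 1 (Num.max 0 k / m).
have n1 : 1 <= n by rewrite le_max lexx.
have n0 : 0 < n by exact: lt_le_trans n1.
have zn : z <= n *: (m *: u).
  rewrite vsup_le scalerA; apply/andP; split; last first.
    by rewrite vl_scale_ge0// mulr_ge0// ltW.
  rewrite vl_leBD; apply: (le_trans yk); rewrite -[leLHS]addr0 vl_leD//.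
    rewrite vl_leZ2// (@le_trans _ _ (Num.max 0 k))//.
      by rewrite le_max lexx orbT.
    by rewrite -ler_pdivrMr// le_max lexx orbT.
  by rewrite vl_scale_ge0// ltW.
suff : z <= 0 by rewrite vsup_le vl_leBD add0r => /andP[].
apply: le_trans (_ : vinf (n *: (m *: u)) z <= _).
  by rewrite le_vinf zn /=.
apply: le_trans (vinfZ_le _ n1 z0) _.
by rewrite -[leRHS](scaler0 X n) vl_leZ ?(ltW n0)// vinfC.
Qed.

End VectorLatticeArithmetic.

(** * Strong units and their norms *)

Section StrongUnit.
Variables (R : realType) (X : vectorLatticeType R).
Implicit Types (x y z u v : X) (l : R).

Lemma strong_unitP u : strong_unit u <->
  0 <= u /\ forall x, exists2 l, 0 <= l & vabs x <= l *: u.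
Proof.
split=> -[u0 h]; split=> //.
  pose I := [set x | exists2 l, 0 <= l & vabs x <= l *: u].
  suff sub : smallest (@order_ideal R X) [set u] `<=` I.
    by move=> x; apply: sub; rewrite h.
  apply: smallest_sub; last first.
    by move=> _ ->; exists 1 => //; rewrite scale1r vabs_id.
  split; first by exists 0 => //; rewrite vabs0 scale0r.
    move=> a x y [l l0 xl] [k k0 yk]; exists (`|a| * l + k).
      by rewrite addr_ge0// mulr_ge0.
    apply: le_trans (vabsD _ _) _; rewrite scalerDl vl_leD// vabsZ -scalerA.
    by rewrite vl_leZ.
  by move=> x y [l l0 yl] xy; exists l => //; exact: le_trans yl.
rewrite -subTset => x _ I [[I0 IZ sI] uI].
have [l l0 xl] := h x; apply: (sI x (l *: u)).
  by rewrite -[l *: u]addr0; apply: IZ => //; exact: uI.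
by rewrite [leRHS]vabs_id// vl_scale_ge0.
Qed.

Lemma unit_norm_has_lbound u x :
  has_lbound [set l : R | 0 <= l /\ vabs x <= l *: u].
Proof. by exists 0 => l []. Qed.

Lemma unit_norm_ge0 u x : 0 <= unit_norm u x.
Proof.
rewrite /unit_norm; set A := [set _ | _].
have [->|/set0P A0] := eqVneq A set0; first by rewrite inf0.
by apply: lb_le_inf => // l [].
Qed.

Lemma unit_norm_le u x l : 0 <= l -> vabs x <= l *: u -> unit_norm u x <= l.
Proof. by move=> l0 xl; apply: ge_inf => //; exact: unit_norm_has_lbound. Qed.

Variable u : X.
Hypothesis su : strong_unit u.

Let u0 : 0 <= u. Proof. by case/strong_unitP: su. Qed.

Lemma unit_norm_lt x l : unit_norm u x < l -> vabs x <= l *: u.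
Proof.
have [_ /(_ x)[k k0 xk]] := (strong_unitP u).1 su.
move=> /inf_lt[|m [m0 xm] ml]; first by exists k.
by apply: le_trans xm _; rewrite vl_leZ2// ltW.
Qed.

Lemma unit_norm_mono x y : vabs x <= vabs y -> unit_norm u x <= unit_norm u y.
Proof.
move=> xy; apply/ler_addgt0Pr => e e0; apply: unit_norm_le.
  by rewrite addr_ge0 ?unit_norm_ge0// ltW.
by apply: le_trans xy _; apply: unit_norm_lt; rewrite ltrDl.
Qed.

Lemma unit_normD x y : unit_norm u (x + y) <= unit_norm u x + unit_norm u y.
Proof.
apply/ler_addgt0Pr => e e0; rewrite [e]splitr addrACA.
have e20 : 0 < e / 2 by rewrite divr_gt0.
apply: unit_norm_le.
  by rewrite !addr_ge0 ?unit_norm_ge0// ltW.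
apply: le_trans (vabsD _ _) _; rewrite scalerDl.
by apply: vl_leD; apply: unit_norm_lt; rewrite ltrDl.
Qed.

Lemma unit_normZ a x : unit_norm u (a *: x) = `|a| * unit_norm u x.
Proof.
have le (b : R) (y : X) : unit_norm u (b *: y) <= `|b| * unit_norm u y.
  have [->|b0] := eqVneq b 0.
    by rewrite normr0 mul0r unit_norm_le// !scale0r vabs0.
  have nb : 0 < `|b| by rewrite normr_gt0.
  apply/ler_addgt0Pr => e e0; apply: unit_norm_le.
    by rewrite addr_ge0 ?mulr_ge0 ?unit_norm_ge0// ltW.
  rewrite vabsZ vl_scale_le// scalerA mulrDr mulKf ?lt0r_neq0//.
  by apply: unit_norm_lt; rewrite ltrDl mulr_gt0// invr_gt0.
apply/eqP; rewrite eq_le le /=.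
have [->|a0] := eqVneq a 0; first by rewrite normr0 mul0r unit_norm_ge0.
rewrite -ler_pdivlMl ?normr_gt0// -normfV.
by rewrite -{1}(scalerK a0 x); exact: le.
Qed.

Lemma unit_normN x : unit_norm u (- x) = unit_norm u x.
Proof. by rewrite -scaleN1r unit_normZ normrN1 mul1r. Qed.

Lemma unit_norm_dist x y : unit_norm u (x - y) = unit_norm u (y - x).
Proof. by rewrite -unit_normN opprB. Qed.

End StrongUnit.

(** * Order intervals as neighbourhoods of zero *)

Section LocallySolidTheory.
Variables (R : realType) (X : locallySolidType R).
Implicit Types (x y z u v w : X) (A U : set X) (e l : R).

Definition sym_interval w : set X := [set x | vabs x <= w].

Lemma nbhs_translate x A : nbhs x A <-> nbhs (0 : X) [set y | A (x + y)].
Proof.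
split.
  have := @add_continuous X (x, 0) A; rewrite /= addr0 => /[apply].
  case=> -[B C] /= [Bx C0] BC; apply: filterS C0 => y Cy.
  by apply: (BC (x, y)); split => //; exact: nbhs_singleton Bx.
have := @add_continuous X (- x, x) [set y | A (x + y)].
rewrite /= addNr => /[apply].
case=> -[B C] /= [Bx Cx] BC; apply: filterS Cx => y Cy.
rewrite -[y](addNKr x); apply: (BC (- x, y)); split => //.
exact: nbhs_singleton Bx.
Qed.

Lemma nbhs0_scale l A : nbhs (0 : X) A -> nbhs (0 : X) [set y | A (l *: y)].
Proof.
have := @scale_continuous R X (l, 0) A; rewrite /= scaler0 => /[apply].
case=> -[B C] /= [Bl C0] BC; apply: filterS C0 => y Cy.
by apply: (BC (l, y)); split => //; exact: nbhs_singleton Bl.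
Qed.

Lemma nbhs0_absorbing x A : nbhs (0 : X) A -> exists2 e, 0 < e & A (e *: x).
Proof.
have := @scale_continuous R X (0, x) A; rewrite /= scale0r => /[apply].
case=> -[B C] /= [/nbhs_ballP[e /= e0 eB] Cx] BC.
have e20 : 0 < e / 2 by rewrite divr_gt0.
exists (e / 2) => //; apply: (BC (e / 2, x)); split => /=.
  apply: eB; rewrite -ball_normE/= sub0r normrN gtr0_norm//.
  by rewrite ltr_pdivrMr// ltr_pMr// ltr1n.
exact: nbhs_singleton Cx.
Qed.

Lemma solid_sym_interval w : solid (sym_interval w).
Proof. by move=> x y yw xy; exact: le_trans yw. Qed.

Lemma sym_interval_absorbed w A : 0 <= w -> nbhs (0 : X) A ->
  exists2 e, 0 < e & sym_interval (e *: w) `<=` A.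
Proof.
move=> w0 /locally_solid[V [V0 sV VA]].
have [e e0 Ve] := nbhs0_absorbing w V0; exists e => // x xw; apply: VA.
by apply: sV Ve _; rewrite [leRHS]vabs_id// vl_scale_ge0// ltW.
Qed.

Lemma nbhs_sym_intervalZ w l : 0 < l -> nbhs (0 : X) (sym_interval w) ->
  nbhs (0 : X) (sym_interval (l *: w)).
Proof.
move=> l0 /(nbhs0_scale l^-1); apply: filterS => x.
rewrite /sym_interval/= vabsZ gtr0_norm ?invr_gt0//.
by rewrite vl_scale_le ?invr_gt0// invrK.
Qed.

Lemma hausdorff0 x : hausdorff_space X ->
  (forall A, nbhs (0 : X) A -> A x) -> x = 0.
Proof.
move=> hX h; apply/esym/hX => A B A0 Bx; exists x; split; first exact: h.
exact: nbhs_singleton Bx.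
Qed.

Lemma has_order_bounded_nbhsP : has_order_bounded_nbhs X <->
  exists2 w, 0 <= w & nbhs (0 : X) (sym_interval w).
Proof.
split=> [[U U0 [a [b Uab]]]|[w w0 nw]]; last first.
  exists (sym_interval w) => //; exists (- w), w => x /=.
  rewrite /sym_interval/= vabs_le => /andP[-> xw].
  by rewrite -vl_oppr_le opprK xw.
exists (vabs a + vabs b); first by rewrite vl_addr_ge0// vabs_ge0.
apply: filterS U0 => x /Uab /= /andP[ax xb]; rewrite /sym_interval/= vabs_le.
apply/andP; split.
  by apply: (le_trans xb); rewrite -[leLHS]add0r vl_leD ?vabs_ge0 ?vsup_lel.
apply: (@le_trans _ _ (- a)); first by rewrite vl_oppr_le.
by rewrite -[leLHS]addr0 vl_leD ?vabs_ge0 ?vsup_ler.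
Qed.

Section OrderUnitNeighbourhood.
Variable w : X.
Hypotheses (w0 : 0 <= w) (nw : nbhs (0 : X) (sym_interval w)).

Lemma nbhs_interval_strong_unit : strong_unit w.
Proof.
apply/strong_unitP; split=> // x.
have [e e0 ex] := nbhs0_absorbing x nw.
exists e^-1; first by rewrite invr_ge0 ltW.
by rewrite -vl_scale_le// -(gtr0_norm e0) -vabsZ.
Qed.

Lemma nbhs_interval_unit_bound x : exists k : R, x <= k *: w.
Proof.
have [_ /(_ x)[k _ xk]] := (strong_unitP w).1 nbhs_interval_strong_unit.
by exists k; apply: le_trans xk; exact: vsup_lel.
Qed.

(** For [l < 1] the vectors whose truncation at [w] lies in the interval of
    [l *: w] are those of this interval, by [vinf_unit_le]. Hence truncation
    at [w] alone recovers the topology. *)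
Lemma unbounded_nbhs0_sub A : nbhs (0 : X) A ->
  exists2 U, nbhs (0 : X) U /\ solid U &
    forall x, U (vinf (vabs x) w) -> A x.
Proof.
move=> A0; have [e e0 eA] := sym_interval_absorbed w0 A0.
(* Any bound below one serves here, as [vinf_unit_le] requires. *)
pose l := Num.min e (1 / 2).
have l0 : 0 < l by rewrite lt_min e0 divr_gt0.
have l1 : l < 1 by rewrite gt_min ltr_pdivrMr// mul1r ltr1n orbT.
exists (sym_interval (l *: w)).
  by split; [exact: nbhs_sym_intervalZ|exact: solid_sym_interval].
move=> x; rewrite /sym_interval/= vabs_id ?vinf_ge0 ?vabs_ge0// => xl.
apply: eA; apply: (@le_trans _ _ (l *: w)).
  apply: vinf_unit_le => //; first by rewrite l0.
  exact: nbhs_interval_unit_bound.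
by rewrite vl_leZ2// ge_min lexx.
Qed.

End OrderUnitNeighbourhood.

Lemma nbhs_unbounded x A : unbounded_nbhs (x : unbounded X) A -> nbhs x A.
Proof.
move=> [U [v [U0 sU v0 UA]]]; apply/nbhs_translate.
apply: filterS U0 => y Uy; apply: UA => /=; rewrite addrC addKr.
apply: sU Uy _; rewrite vabs_id ?vinf_ge0 ?vabs_ge0//; exact: vinf_lel.
Qed.

Lemma nbhs_interval_unbounded w : 0 <= w -> nbhs (0 : X) (sym_interval w) ->
  forall x, nbhs x = unbounded_nbhs (x : unbounded X).
Proof.
move=> w0 nw x; apply/seteqP; split=> A; last exact: nbhs_unbounded.
move=> /nbhs_translate /(unbounded_nbhs0_sub w0 nw)[U [U0 sU] UA].
by exists U, w; split=> // y /= /UA /=; rewrite addrC subrK.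
Qed.

Lemma nbhs_interval_locally_bounded w : 0 <= w ->
  nbhs (0 : X) (sym_interval w) -> locally_bounded (unbounded X).
Proof.
move=> w0 nw; exists (sym_interval w).
  by have := nbhs_interval_unbounded w0 nw 0 => e; rewrite /nbhs/= -e.
move=> A /nbhs_unbounded/(sym_interval_absorbed w0)[e e0 eA].
exists e => // _ [x xw <-]; apply: eA.
by rewrite /sym_interval/= vabsZ gtr0_norm// vl_leZ// ltW.
Qed.

(** Let the basic neighbourhood given by [U] and [v] be bounded. If it
    contained some [x] outside the interval of [v], then by [vinf_excess_le]
    it would contain all large multiples of the positive part [y] of
    [vabs x - v]. Boundedness then puts [y] into every neighbourhood of zero,
    so [y = 0] by separation. *)
Lemma locally_bounded_unbounded_interval : hausdorff_space X ->
  locally_bounded (unbounded X) ->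
  exists2 w, 0 <= w & nbhs (0 : unbounded X) (sym_interval w).
Proof.
move=> hX [S [U [v [U0 sU v0 US]]] bS]; exists v => //.
exists U, v; split=> // x /=; rewrite subr0 => Ux.
suff : vsup (vabs x - v) 0 <= 0.
  by rewrite vsup_le vl_leBD add0r => /andP[].
set y := vsup _ _; suff -> : y = 0 by [].
have y0 : 0 <= y by exact: vsup_ler.
have Sy l : 1 <= l -> S (l *: y).
  move=> l1; apply: US => /=; rewrite subr0 vabs_id; last first.
    by rewrite vl_scale_ge0// (le_trans _ l1).
  apply: solid_ge0 Ux _ _ => //.
    by rewrite vinf_ge0// vl_scale_ge0// (le_trans _ l1).
  by rewrite le_vinf vinf_ler andbT vinf_excess_le// vabs_ge0.
apply: hausdorff0 => // A /locally_solid[V [V0 sV VA]]; apply: VA.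
(* Truncation at [y] itself returns [y] from its multiples. *)
have nV : nbhs (0 : unbounded X) [set z : X | V (vinf (vabs z) y)].
  by exists V, y; split=> // z /=; rewrite subr0.
have [e e0 eS] := bS _ nV.
pose l := Num.max 1 e^-1.
have l1 : 1 <= l by rewrite le_max lexx.
have /eS/= : [set e *: x | x in S] (e *: (l *: y)).
  by exists (l *: y) => //; exact: Sy.
have ely0 : 0 <= e *: (l *: y).
  by rewrite !vl_scale_ge0// ?(ltW e0)// (le_trans _ l1).
rewrite vabs_id// => h; apply: solid_ge0 h _ _ => //.
rewrite le_vinf lexx andbT scalerA -{1}[y]scale1r vl_leZ2//.
by rewrite -ler_pdivrMl// mulr1 le_max lexx orbT.
Qed.

End LocallySolidTheory.

(** * The topology of a unit norm *)

Section UnitNormTopology.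
Variables (R : realType) (X : locallySolidType R).
Variable w : X.
Hypotheses (w0 : 0 <= w) (nw : nbhs (0 : X) (sym_interval w)).

Let su : strong_unit w := nbhs_interval_strong_unit w0 nw.

Lemma nbhs_unit_norm_ball (x : X) :
  nbhs x = nbhs_ball_ (ball_ (unit_norm w)) x.
Proof.
apply/seteqP; split=> A.
  move=> /nbhs_translate/(sym_interval_absorbed w0)[e e0 eA].
  exists e => // y /= xy; rewrite -[y](subrKC x); apply: eA.
  by apply: (unit_norm_lt su); rewrite unit_norm_dist.
move=> [e /= e0 eA]; apply/nbhs_translate.
have e20 : 0 < e / 2 by rewrite divr_gt0.
apply: filterS (nbhs_sym_intervalZ e20 nw) => y yw; apply: eA.
rewrite /ball_/= opprD addNKr unit_normN//.
apply: (@le_lt_trans _ _ (e / 2)).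
  by apply: unit_norm_le => //; exact: ltW.
by rewrite ltr_pdivrMr// ltr_pMr// ltr1n.
Qed.

Lemma unit_norm_eq0 (x : X) : hausdorff_space X -> unit_norm w x = 0 -> x = 0.
Proof.
move=> hX x0; apply: hausdorff0 => // A /(sym_interval_absorbed w0)[e e0].
by apply; apply: (unit_norm_lt su); rewrite x0.
Qed.

Lemma unit_norm_lattice_norm : hausdorff_space X -> lattice_norm (unit_norm w).
Proof.
move=> hX; split=> [x|a x|x y|x y].
- exact: unit_norm_eq0.
- exact: unit_normZ.
- exact: unit_normD.
- exact: unit_norm_mono.
Qed.

Lemma nbhs_interval_metrizable : hausdorff_space X -> metrizable R X.
Proof.
move=> hX; exists (fun x y => unit_norm w (x - y)); split.
- move=> x y; split; first exact: unit_norm_ge0.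
  split=> [/(unit_norm_eq0 hX)/subr0_eq//|->].
  apply/eqP; rewrite subrr eq_le unit_norm_ge0 andbT.
  by rewrite unit_norm_le// vabs0 scale0r.
- by move=> x y; exact: unit_norm_dist.
- move=> x y z; rewrite -[x - z](subrKA y); exact: unit_normD.
- exact: nbhs_unit_norm_ball.
Qed.

Lemma unit_norm_complete : tvs_complete X -> norm_complete (unit_norm w).
Proof.
move=> cX f fC.
have [|x fx] := cX (f @ \oo) _.
  move=> A /(sym_interval_absorbed w0)[e e0 eA].
  have [n0 fn0] := fC _ e0.
  exists (f @` [set n | (n0 <= n)%N]).
    by exists n0 => // n /= n0n; exists n.
  move=> _ _ [m mn0 <-] [n nn0 <-]; apply: eA.
  by apply: (unit_norm_lt su); exact: fn0.
exists x; apply/cvgrPdist_lt => e e0.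
have nB : nbhs x (ball_ (unit_norm w) x e).
  by rewrite nbhs_unit_norm_ball; exists e.
have : \forall n \near \oo, ball_ (unit_norm w) x e (f n) by exact: fx nB.
apply: filterS => n /=; rewrite sub0r normrN ger0_norm ?unit_norm_ge0//.
by rewrite unit_norm_dist.
Qed.

End UnitNormTopology.

Lemma ball_unit_norm_nbhs_interval (R : realType) (X : locallySolidType R)
    (u : X) : strong_unit u ->
  (forall x : X, nbhs x = nbhs_ball_ (ball_ (unit_norm u)) x) ->
  nbhs (0 : X) (sym_interval u).
Proof.
move=> su nE; rewrite nE; exists 1 => //= x.
rewrite /ball_/= sub0r unit_normN// => /(unit_norm_lt su).
by rewrite scale1r.
Qed.

(** * Passing to the completion *)

Section Completion.
Variables (R : realType) (X Xh : locallySolidType R) (i : {linear X -> Xh}).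
Hypothesis hXh : is_completion i.

Lemma completion_le (x y : X) : (i x <= i y) = (x <= y).
Proof.
rewrite -!vsup_idr -(completion_sup hXh); apply/eqP/eqP => [|->//].
exact: (completion_injective hXh).
Qed.

Lemma completion_vabs (x : X) : i (vabs x) = vabs (i x).
Proof. by rewrite /vabs (completion_sup hXh) linearN. Qed.

Lemma completion_nbhs0 (A : set X) :
  nbhs (0 : X) A <-> exists2 B, nbhs (0 : Xh) B & i @^-1` B `<=` A.
Proof.
rewrite (completion_nbhs hXh) linear0; by split=> -[B B0 BA]; exists B.
Qed.

(** A closed set that contains the trace of an open set on the dense subspace
    contains the open set itself. *)
Lemma nbhs0_closed_preimage (P : set Xh) : closed P ->
  nbhs (0 : X) (i @^-1` P) -> nbhs (0 : Xh) P.
Proof.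
move=> cP /completion_nbhs0 [B B0 BP].
rewrite nbhsE in B0; case: B0 => G [Go G0] GB.
apply: (@filterS _ (nbhs (0 : Xh)) _ G); last by apply: open_nbhs_nbhs; split.
move=> z Gz; apply: cP => V; rewrite nbhsE => -[W [Wo Wz] WV].
have [|t [[Wx Gx] [x _ xE]]] :=
    completion_dense hXh (_ : W `&` G !=set0) (openI Wo Go).
  by exists z.
exists (i x); split; last by rewrite xE; exact: WV.
by apply: BP; rewrite /= xE; exact: GB.
Qed.

Lemma completion_closed_cone : closed [set z : Xh | 0 <= z].
Proof. by rewrite (completion_cone hXh); exact: closed_closure. Qed.

Lemma completion_closed_le (z : Xh) : closed [set y : Xh | y <= z].
Proof.
have -> : [set y : Xh | y <= z] = (fun y => z - y) @^-1` [set y | 0 <= y].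
  by apply/seteqP; split=> y /=; rewrite vl_subr_ge0.
apply: (continuous_closedP _).1 completion_closed_cone => y.
apply: (@continuous_comp _ _ _ (fun y => (z, y))
  (fun x : Xh * Xh => x.1 - x.2)).
  by apply: cvg_pair; [exact: cvg_cst|exact: cvg_id].
exact: sub_continuous.
Qed.

Lemma completion_closed_ge (z : Xh) : closed [set y : Xh | z <= y].
Proof.
have -> : [set y : Xh | z <= y] = (fun y => - y) @^-1` [set y : Xh | y <= - z].
  by apply/seteqP; split=> y /=; rewrite vl_oppr_le.
apply: (continuous_closedP _).1 (@completion_closed_le (- z)) => y.
exact: opp_continuous.
Qed.

Lemma completion_closed_sym_interval (w : Xh) : closed (sym_interval w).
Proof.
have -> : sym_interval w = [set y | y <= w] `&` [set y | - w <= y].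
  apply/seteqP; split=> y /=; rewrite /sym_interval/= vabs_le.
    by move=> /andP[-> yw]; rewrite -vl_oppr_le opprK.
  by move=> [-> wy]; rewrite -vl_oppr_le opprK.
by apply: closedI; [exact: completion_closed_le|exact: completion_closed_ge].
Qed.

Lemma completion_nbhs_interval (w : X) :
  nbhs (0 : X) (sym_interval w) -> nbhs (0 : Xh) (sym_interval (i w)).
Proof.
move=> nw; apply: nbhs0_closed_preimage.
  exact: completion_closed_sym_interval.
apply: filterS nw => x xw.
by rewrite /sym_interval/= -completion_vabs completion_le.
Qed.

(** The interval of [w] need not be given by a vector of [X]. By density some
    [x] in [X] lies in [w + w + sym_interval w], and then [w <= i x]. *)
Lemma completion_nbhs_interval_inv (w : Xh) : 0 <= w ->
  nbhs (0 : Xh) (sym_interval w) ->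
  exists2 x : X, 0 <= x & nbhs (0 : X) (sym_interval x).
Proof.
move=> w0 nw.
have : nbhs (w + w) [set z | w <= z].
  apply/nbhs_translate; apply: filterS nw => z /=.
  rewrite /sym_interval/= vabs_le => /andP[_ zw].
  rewrite -addrA -[leLHS]addr0 vl_leD//.
  by have := vl_leD2r z _ _ zw; rewrite addNr.
rewrite nbhsE => -[G [Go Gw] Ggt].
have [|t [/Ggt/= wx [x _ xE]]] := completion_dense hXh (_ : G !=set0) Go.
  by exists (w + w).
exists x; first by rewrite -completion_le linear0 xE (le_trans w0).
apply/completion_nbhs0; exists (sym_interval w) => // y yw.
rewrite /sym_interval/= -completion_le completion_vabs xE.
exact: le_trans wx.
Qed.

(** The closures of a countable base of [X] work: they are neighbourhoods by
    [nbhs0_closed_preimage], and they are small because the closure of [W]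
    lies in [W + W]. *)
Lemma completion_countable_base : metrizable R X ->
  exists2 V : nat -> set Xh, (forall n, nbhs (0 : Xh) (V n)) &
    forall A, nbhs (0 : Xh) A -> exists n, V n `<=` A.
Proof.
move=> [d [_ _ _ dE]].
pose B n := [set x : X | d 0 x < n.+1%:R^-1].
exists (fun n => closure (i @` B n)) => [n|A].
  apply: nbhs0_closed_preimage; first exact: closed_closure.
  rewrite dE; exists n.+1%:R^-1 => /=; first by rewrite invr_gt0.
  by move=> x dx; apply: subset_closure; exists x.
move=> /solid_half[W [W0 sW WA]].
have : nbhs (0 : X) (i @^-1` W) by apply/completion_nbhs0; exists W.
rewrite dE => -[e /= e0 eW].
have [n ne] : exists n, n.+1%:R^-1 < e :> R.
  have [N _ hN] := near_infty_natSinv_lt (PosNum e0).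
  by exists N; apply: (hN N) => /=.
exists n => z zB.
have [_ [[x Bx <-] /= Wz]] : (i @` B n) `&` [set y | W (y - z)] !=set0.
  apply: zB; apply/nbhs_translate; apply: filterS W0 => y /=.
  by rewrite addrC addKr.
rewrite -[z](subKr (i x)); apply: WA; first by apply: eW; exact: lt_trans ne.
by apply: (sW _ _ Wz); rewrite vabsN.
Qed.

(** A series takes the place of the Baire category theorem. If the interval of
    [u] were not a neighbourhood, then every member of a decreasing countable
    base [U] would contain some [x n >= 0] that is not below [n%:R *: u]. When
    [U n.+1 + U n.+1] lies in [U n], the sum [z] of the series of the [x n]
    exists by completeness. It dominates every [x n] because the cone is
    closed, and it is itself below some multiple of [u]: a contradiction. *)
Lemma strong_unit_nbhs_interval (u : Xh) : metrizable R X -> strong_unit u ->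
  nbhs (0 : Xh) (sym_interval u).
Proof.
move=> /completion_countable_base[V V0 VA] /strong_unitP[u0 su].
apply: contrapT => nu.
have bad n (A : set Xh) : nbhs (0 : Xh) A ->
    exists x, [/\ 0 <= x, A x & ~ (x <= n%:R *: u)].
  move=> /locally_solid[W [W0 sW WA]]; apply: contrapT => h; apply: nu.
  have n0 : (0 : R) < n.+1%:R by [].
  apply: filterS (nbhs0_scale n.+1%:R W0) => x /= Wx.
  rewrite /sym_interval/= -[leRHS](scalerK (lt0r_neq0 n0)).
  rewrite -vl_scale_le// -(gtr0_norm n0) -vabsZ (gtr0_norm n0).
  apply: contrapT => nx; apply: h; exists (vabs (n.+1%:R *: x)); split.
  - exact: vabs_ge0.
  - by apply: WA; apply: sW Wx _; rewrite vabs_id ?vabs_ge0.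
  - by apply: contra_not nx => /le_trans; apply; rewrite vl_leZ2// ler_nat.
(* Stated for all sets, so that [choice] gives a halving function. *)
have half (A : set Xh) : exists W : set Xh, nbhs (0 : Xh) A ->
    [/\ nbhs (0 : Xh) W, solid W & forall x y, W x -> W y -> A (x + y)].
  have [/solid_half[W hW]|nA] := pselect (nbhs (0 : Xh) A); first by exists W.
  by exists A.
have [h hh] := choice half.
pose U := fix U n := if n is n'.+1 then h (U n' `&` V n') else h (V 0).
have U0 n : nbhs (0 : Xh) (U n).
  elim: n => [|n IH] /=; first by have [] := hh _ (V0 0).
  by have [] := hh _ (filterI IH (V0 n)).
have sU n : solid (U n).
  case: n => [|n] /=; first by have [] := hh _ (V0 0).
  by have [] := hh _ (filterI (U0 n) (V0 n)).
have UU n x y : U n.+1 x -> U n.+1 y -> U n (x + y).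
  have [_ _ h1] := hh _ (filterI (U0 n) (V0 n)) => Ux Uy.
  by have [] := h1 x y Ux Uy.
have UV n x : U n.+1 x -> V n x.
  have [n1 _ h1] := hh _ (filterI (U0 n) (V0 n)) => Ux.
  by have [_] := h1 x 0 Ux (nbhs_singleton n1); rewrite addr0.
have [x hx] := choice (fun n => bad n _ (U0 n)).
pose S n := \sum_(k < n) x k.
have S0 : {homo S : m n / (m <= n)%N >-> m <= n}.
  apply: homo_leq => [//|y ? ?|n]; first exact: le_trans.
  by rewrite /S big_ord_recr -[leLHS]addr0 vl_leD//; have [] := hx n.
(* The tail from [n.+1] on stays in [U n], whatever its length [k]. *)
have SU n k : U n (S (n.+1 + k)%N - S n.+1).
  elim: k n => [|k IH] n.
    by rewrite addn0 subrr; exact: nbhs_singleton (U0 n).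
  rewrite addnS -addSn -(subrKA (S n.+2)); apply: UU; first exact: IH.
  have -> : S n.+2 - S n.+1 = x n.+1.
    by rewrite /S big_ord_recr/= addrAC subrr add0r.
  by have [] := hx n.+1.
have [|z Sz] := completion_complete hXh (_ : ProperFilter (S @ \oo)) _.
  move=> A /solid_half[W [W0 sW WA]]; have [n Vn] := VA _ W0.
  exists (S @` [set m | (n.+2 <= m)%N]).
    by exists n.+2 => // m /= ?; exists m.
  have WS m : (n.+2 <= m)%N -> W (S m - S n.+2).
    by move=> nm; apply: Vn; apply: UV; rewrite -(subnKC nm); exact: SU.
  move=> _ _ [m nm <-] [p np <-]; rewrite -(subrKA (S n.+2)); apply: WA.
    exact: WS.
  by apply: sW (WS p np) _; rewrite -opprB vabsN.
have xz n : x n <= z.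
  apply: (@closed_cvg _ _ \oo _ S (fun y => x n <= y) _ _ z Sz).
    exact: completion_closed_ge.
  exists n.+1 => // m /= nm; apply: le_trans (S0 _ _ nm).
  rewrite /S big_ord_recr/= -[leLHS]add0r vl_leD//.
  by have := S0 _ _ (leq0n n); rewrite {1}/S big_ord0.
have [l l0 zl] := su z.
have [n ln] : exists n : nat, l <= n%:R.
  by exists (Num.truncn l).+1; exact/ltW/truncnS_gt.
have [_ _] := hx n; apply; apply: le_trans (xz n) _.
apply: le_trans (vsup_lel _ _) _; apply: le_trans zl _; exact: vl_leZ2.
Qed.

End Completion.

(** * Existence of lattice homomorphisms *)

Section LatticeHomomorphisms.
Variables (R : realType) (X : vectorLatticeType R) (u : X).
Hypothesis su : strong_unit u.
Implicit Types (x y z : X) (p q g : X -> R) (l t : R) (A : set (X -> R)).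

Definition unital_hom (f : X -> R) : Prop :=
  [/\ forall (a : R) x y, f (a *: x + y) = a * f x + f y,
      forall x y, f (vsup x y) = Num.max (f x) (f y) &
      f u = 1].

Lemma unital_homN f x : unital_hom f -> f (- x) = - f x.
Proof.
move=> [fl _ _].
have f0 : f 0 = 0 by have := fl (-1) 0 0; rewrite scaler0 addr0 mulN1r addNr.
by have := fl (-1) x 0; rewrite addr0 f0 addr0 scaleN1r mulN1r.
Qed.

Lemma unital_hom_vabs f x : unital_hom f -> f (vabs x) = `|f x|.
Proof.
move=> hf; have [_ fm _] := hf; rewrite fm unital_homN//.
have [h|h] := leP 0 (f x).
  by rewrite ger0_norm// max_l// (le_trans _ h)// oppr_le0.
by rewrite ltr0_norm// max_r// ltW// (lt_trans h)// oppr_gt0.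
Qed.

(** Suprema over non-empty closed sets of unital homomorphisms have these
    properties. They play the part of closed sets in a search for points: a
    minimal functional of this kind is a single homomorphism. *)
Definition sup_sublinear p : Prop :=
  [/\ forall x y, p (vsup x y) = Num.max (p x) (p y),
      forall x y, p (x + y) <= p x + p y,
      forall l x, 0 < l -> p (l *: x) <= l * p x &
      p u <= 1 /\ p (- u) <= -1].

Lemma sup_sublinear_mono p x y : sup_sublinear p -> x <= y -> p x <= p y.
Proof.
by move=> [pm _ _ _]; rewrite -vsup_idr => /eqP <-; rewrite pm le_max lexx.
Qed.

Lemma sup_sublinear0 p : sup_sublinear p -> p 0 = 0.
Proof.
move=> [_ pD _ [pu pNu]]; apply/eqP; rewrite eq_le; apply/andP; split.
  by rewrite -(subrr u) (le_trans (pD _ _))// -(subrr (1 : R)) lerD.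
by have := pD 0 0; rewrite addr0 -{1}[p 0]addr0 lerD2l.
Qed.

Lemma sup_sublinear_oppr p x : sup_sublinear p -> - p (- x) <= p x.
Proof.
move=> sp; have [_ pD _ _] := sp.
by rewrite lerNl -subr_ge0 opprK addrC -(sup_sublinear0 sp) -(subrr x) pD.
Qed.

Lemma sup_sublinearZ p l x : sup_sublinear p -> 0 <= l -> p (l *: x) = l * p x.
Proof.
move=> sp; have [_ _ pZ _] := sp.
rewrite le_eqVlt => /predU1P[<-|l0].
  by rewrite scale0r mul0r sup_sublinear0.
apply/eqP; rewrite eq_le pZ//= -ler_pdivlMl//.
by rewrite -{1}(scalerK (lt0r_neq0 l0) x) pZ// invr_gt0.
Qed.

Lemma sup_sublinear_le p l x : sup_sublinear p -> x <= l *: u -> p x <= l.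
Proof.
move=> sp /(sup_sublinear_mono sp)/le_trans; apply.
have [_ _ _ [pu pNu]] := sp.
have [l0|l0] := leP 0 l; first by rewrite sup_sublinearZ// ler_piMr.
rewrite -(opprK l) scaleNr -scalerN sup_sublinearZ//; last first.
  by rewrite oppr_ge0 ltW.
by rewrite -[leRHS]mulrN1 ler_wpM2l// oppr_ge0 ltW.
Qed.

Lemma sup_sublinear_lbound x :
  exists b : R, forall p, sup_sublinear p -> b <= p x.
Proof.
have [_ /(_ (- x))[k _ xk]] := (strong_unitP u).1 su.
exists (- k) => p sp; apply: le_trans (sup_sublinear_oppr x sp).
rewrite lerN2; apply: (sup_sublinear_le sp); apply: le_trans xk; exact: vsup_lel.
Qed.

(** Preservation of suprema passes to the infimum because the family is a
    chain: the smaller of two members is almost minimal at both points.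
    Subadditivity and homogeneity are only asked up to a change of the member,
    since the family used in [sup_sublinear_below] has them in this form
    only. *)
Lemma sup_sublinear_inf A : A !=set0 ->
  (forall x, exists b : R, forall g, A g -> b <= g x) ->
  (forall g h, A g -> A h ->
    (forall x, g x <= h x) \/ (forall x, h x <= g x)) ->
  (forall g x y, A g -> g (vsup x y) = Num.max (g x) (g y)) ->
  (forall g h x y, A g -> A h -> exists2 k, A k & k (x + y) <= g x + h y) ->
  (forall g l x, A g -> 0 < l -> exists2 h, A h & h (l *: x) <= l * g x) ->
  (exists2 g, A g & g u <= 1) -> (exists2 g, A g & g (- u) <= -1) ->
  sup_sublinear (fun x => inf [set g x | g in A]).
Proof.
move=> [g0 Ag0] lbA chA Am AD AZ [gu Agu gu1] [gv Agv gv1].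
have infle g x : A g -> inf [set h x | h in A] <= g x.
  move=> Ag; apply: ge_inf; last by exists g.
  by have [b bA] := lbA x; exists b => _ [h /bA ? <-].
have leinf (b : R) x :
    (forall g, A g -> b <= g x) -> b <= inf [set h x | h in A].
  move=> bA; apply: lb_le_inf; first by exists (g0 x); exists g0.
  by move=> _ [h /bA ? <-].
have infe x (e : R) :
    0 < e -> exists2 g, A g & g x < inf [set h x | h in A] + e.
  move=> e0; have /inf_lt[|_ [g Ag <-] ge] :
    inf [set h x | h in A] < inf [set h x | h in A] + e by rewrite ltrDl.
  - by exists (g0 x); exists g0.
  - by exists g.
split.
- move=> x y; apply/eqP; rewrite eq_le; apply/andP; split; last first.
    rewrite ge_max; apply/andP; split; apply: leinf => g Ag.
      by apply: le_trans (infle _ _ Ag) _; rewrite Am// le_max lexx.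
    by apply: le_trans (infle _ _ Ag) _; rewrite Am// le_max lexx orbT.
  apply/ler_addgt0Pr => e e0.
  have [g Ag gx] := infe x _ e0; have [h Ah hy] := infe y _ e0.
  wlog : x y g h Ag Ah gx hy / forall z, g z <= h z => [hw|gh].
    have [gh|hg] := chA _ _ Ag Ah; first exact: (hw x y g h).
    by rewrite vsupC maxC; exact: (hw y x h g).
  apply: le_trans (infle _ _ Ag) _; rewrite Am// ge_max addr_maxl le_max ltW//=.
  by rewrite le_max (le_trans (gh y) (ltW hy)) orbT.
- move=> x y; apply/ler_addgt0Pr => e e0; rewrite [e]splitr addrACA.
  have e20 : 0 < e / 2 by rewrite divr_gt0.
  have [g Ag gx] := infe x _ e20; have [h Ah hy] := infe y _ e20.
  have [k Ak kgh] := AD _ _ x y Ag Ah; apply: le_trans (infle _ _ Ak) _.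
  by rewrite (le_trans kgh)// lerD// ltW.
- move=> l x l0; rewrite -ler_pdivrMl//; apply: leinf => g Ag.
  have [h Ah hg] := AZ _ _ x Ag l0.
  by rewrite ler_pdivrMl// (le_trans (infle _ _ Ah)).
- by split; [apply: le_trans gu1|apply: le_trans gv1]; exact: infle.
Qed.

(** If [p] is the supremum over a compact set of points, then [q] is the
    supremum over the subset on which [y] attains its maximum [p y]: as [t]
    grows, the points where [y] is smaller stop contributing to
    [p (x + t *: y) - t * p y]. *)
Lemma sup_sublinear_below p y : sup_sublinear p ->
  exists q, [/\ sup_sublinear q, forall x, q x <= p x & q (- y) <= - p y].
Proof.
move=> sp; have [pm pD pZ [pu pNu]] := sp.
pose g t x := p (x + t *: y) - t * p y.
have g0 x : g 0 x = p x by rewrite /g scale0r addr0 mul0r subr0.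
have lbg t x : 0 <= t -> - p (- x) <= g t x.
  move=> t0; rewrite lerBrDr -sup_sublinearZ// addrC lerBlDr addrC.
  by rewrite (le_trans _ (pD _ _))// addrA addNr add0r.
have gmono s t x : s <= t -> g t x <= g s x.
  move=> st; rewrite lerBlDr addrAC -addrA -mulrBl.
  rewrite -sup_sublinearZ// ?subr_ge0// (le_trans _ (pD _ _))//.
  by rewrite -addrA -scalerDl subrKC.
pose A := [set g t | t in [set t | 0 <= t]].
have Ag t : 0 <= t -> A (g t) by exists t.
have infle t x : 0 <= t -> inf [set h x | h in A] <= g t x.
  move=> t0; apply: ge_inf; last by exists (g t) => //; exact: Ag.
  by exists (- p (- x)) => _ [_ [s s0 <-] <-]; exact: lbg.
exists (fun x => inf [set h x | h in A]); split.
- apply: sup_sublinear_inf.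
  + by exists (g 0); exact: Ag.
  + by move=> x; exists (- p (- x)) => _ [s s0 <-]; exact: lbg.
  + move=> _ _ [s s0 <-] [t t0 <-].
    by have [st|/ltW ts] := leP s t; [right|left] => x; exact: gmono.
  + move=> _ x z [s s0 <-]; rewrite /g -addr_maxl -pm; congr (p _ - _).
    apply: le_anti; rewrite -vl_le_subr !vsup_le !vl_le_subr.
    rewrite vsup_lel vsup_ler/=.
    by apply/andP; split; apply: vl_leD2r; [exact: vsup_lel|exact: vsup_ler].
  + move=> _ _ x z [s s0 <-] [t t0 <-]; exists (g (s + t)).
      by apply: Ag; exact: addr_ge0.
    rewrite /g scalerDl mulrDl opprD addrACA [leRHS]addrACA lerD2r; exact: pD.
  + move=> _ l x [s s0 <-] l0; exists (g (l * s)).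
      by apply: Ag; rewrite mulr_ge0// ltW.
    by rewrite /g -scalerA -scalerDr mulrBr mulrA lerD2r pZ.
  + by exists (g 0); [exact: Ag|rewrite g0].
  + by exists (g 0); [exact: Ag|rewrite g0].
- by move=> x; rewrite -(g0 x); exact: infle.
- apply: le_trans (infle 1 _ ler01) _.
  by rewrite /g scale1r addNr sup_sublinear0// add0r mul1r.
Qed.

Lemma sup_sublinear_minimal p : sup_sublinear p ->
  exists m, [/\ sup_sublinear m, forall x, m x <= p x &
    forall q, sup_sublinear q -> (forall x, q x <= m x) -> q = m].
Proof.
move=> sp.
pose T := {m : X -> R | sup_sublinear m /\ forall x, m x <= p x}.
pose r (m q : T) := `[< forall x, sval q x <= sval m x >].
have [|m q n /asboolP mq /asboolP qn|m q /asboolP mq /asboolP qm|A chA|m hm] :=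
  @Zorn T r.
- by move=> m; apply/asboolP.
- by apply/asboolP => x; exact: le_trans (qn x) (mq x).
- case: m q mq qm => [m ?] [q ?] /= mq qm.
  by apply/eq_exist/funext => x; apply/eqP; rewrite eq_le mq qm.
- have [->|/set0P[m0 Am0]] := eqVneq A set0.
    have hp : sup_sublinear p /\ forall x, p x <= p x by split.
    by exists (exist _ p hp).
  pose B := [set sval m | m in A].
  have lbB x : exists b : R, forall g, B g -> b <= g x.
    have [b hb] := sup_sublinear_lbound x.
    by exists b => _ [[g [sg gp]] Ag <-]; exact: hb.
  have infle m x : A m -> inf [set g x | g in B] <= sval m x.
    move=> Am; apply: ge_inf; last by exists (sval m) => //; exists m.
    by have [b bB] := lbB x; exists b => _ [h /bB ? <-].
  have chB (g h : X -> R) : B g -> B h ->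
      (forall x, g x <= h x) \/ (forall x, h x <= g x).
    move=> [m Am <-] [n An <-].
    by have [/asboolP|/asboolP] := chA _ _ Am An; [right|left].
  have sB : sup_sublinear (fun x => inf [set g x | g in B]).
    apply: sup_sublinear_inf => //.
    + by exists (sval m0); exists m0.
    + by move=> _ x y [[m [sm mp]] Am <-]; have [h _ _ _] := sm; exact: h.
    + move=> g h x y Bg Bh.
      have [Am Ah] : sup_sublinear g /\ sup_sublinear h.
        by move: Bg Bh => [[m [sm ?]] ? <-] [[n [sn ?]] ? <-].
      have [gh|hg] := chB _ _ Bg Bh; [exists g|exists h] => //.
        by case: Am => _ gD _ _; rewrite (le_trans (gD _ _))// lerD2l.
      by case: Ah => _ hD _ _; rewrite (le_trans (hD _ _))// lerD2r.
    + move=> g l x Bg l0; exists g => //; case: Bg => [[m [sm mp]] Am <-].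
      by have [_ _ h _] := sm; exact: h.
    + by exists (sval m0); [exists m0|case: (svalP m0) => -[? ? ? []]].
    + by exists (sval m0); [exists m0|case: (svalP m0) => -[? ? ? []]].
  have hB : sup_sublinear (fun x => inf [set g x | g in B]) /\
      forall x, inf [set g x | g in B] <= p x.
    split=> // x; apply: le_trans (infle m0 x Am0) _; exact: (svalP m0).2.
  exists (exist _ (fun x => inf [set g x | g in B]) hB) => m Am.
  by apply/asboolP => x; exact: infle.
exists (sval m); have [sm mp] := svalP m; split=> // q sq qm.
have hq : sup_sublinear q /\ forall x, q x <= p x.
  by split=> // x; exact: le_trans (qm x) (mp x).
by rewrite -(hm (exist _ q hq))//; apply/asboolP.
Qed.

(** A minimal functional [m] coincides with the smaller one that
    [sup_sublinear_below] gives for [y], whence [m (- y) <= - m y]. An odd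
    sublinear functional is linear. *)
Lemma unital_hom_below p : sup_sublinear p ->
  exists2 f, unital_hom f & forall x, f x <= p x.
Proof.
move=> /sup_sublinear_minimal[m [sm mp mmin]]; exists m => //.
have [mm mD mZ [mu mNu]] := sm.
have mN y : m (- y) = - m y.
  apply/eqP; rewrite eq_le lerNl sup_sublinear_oppr// andbT.
  by have [q [sq qm qy]] := sup_sublinear_below y sm; rewrite -{1}(mmin q).
have mDE x y : m (x + y) = m x + m y.
  apply/eqP; rewrite eq_le mD /= -lerN2 -mN !opprD -!mN; exact: mD.
split=> //; last first.
  by apply/eqP; rewrite eq_le mu/= -lerN2 -mN.
move=> a x y; rewrite mDE; congr (_ + _).
have [a0|/ltW a0] := leP 0 a; first exact: sup_sublinearZ.
by rewrite -[in LHS](opprK a) scaleNr mN sup_sublinearZ ?oppr_ge0// mulNr opprK.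
Qed.

Hypothesis un0 : u != 0.

Let u0 : 0 <= u. Proof. by case/strong_unitP: su. Qed.

Lemma unit_le_scale (k l : R) : k *: u <= l *: u -> k <= l.
Proof.
move=> kl; rewrite leNgt; apply/negP => lk; move/eqP: un0; apply.
apply: le_anti; rewrite u0 andbT.
have kl0 : 0 < k - l by rewrite subr_gt0.
by rewrite -(scalerK (lt0r_neq0 kl0) u) vl_scale_le ?invr_gt0// invrK scaler0
  scalerBl vl_leBD add0r.
Qed.

(** The supremum of [x] over all unital homomorphisms. *)
Definition upper_bound_unit x : R := inf [set l | x <= l *: u].

Lemma sup_sublinear_upper_bound : sup_sublinear upper_bound_unit.
Proof.
have ne x : [set l | x <= l *: u] !=set0.
  have [_ /(_ x)[k _ xk]] := (strong_unitP u).1 su.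
  by exists k; apply: le_trans xk; exact: vsup_lel.
have lb x : has_lbound [set l | x <= l *: u].
  have [_ /(_ x)[k _ xk]] := (strong_unitP u).1 su.
  exists (- k) => l /= xl; apply: unit_le_scale; apply: le_trans xl.
  rewrite -vl_oppr_le scaleNr opprK; apply: le_trans xk; exact: vsup_ler.
have infle x l : x <= l *: u -> upper_bound_unit x <= l.
  by move=> xl; exact: ge_inf.
have ltinf x l : upper_bound_unit x < l -> x <= l *: u.
  move=> /inf_lt[//|m xm ml]; apply: (le_trans xm).
  by rewrite vl_leZ2// ltW.
have mono x y : x <= y -> upper_bound_unit x <= upper_bound_unit y.
  move=> xy; apply/ler_addgt0Pr => e e0; apply: infle.
  by apply: (le_trans xy); apply: ltinf; rewrite ltrDl.
split.
- move=> x y; apply/eqP; rewrite eq_le; apply/andP; split; last first.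
    rewrite ge_max; apply/andP.
    by split; apply: mono; rewrite ?vsup_lel ?vsup_ler.
  apply/ler_addgt0Pr => e e0; apply: infle; rewrite vsup_le.
  by apply/andP; split; apply: ltinf; rewrite addr_maxl lt_max ltrDl e0 ?orbT.
- move=> x y; apply/ler_addgt0Pr => e e0; rewrite [e]splitr addrACA; apply: infle.
  have e20 : 0 < e / 2 by rewrite divr_gt0.
  by rewrite scalerDl; apply: vl_leD; apply: ltinf; rewrite ltrDl.
- move=> l x l0; rewrite -ler_pdivrMl//; apply/ler_addgt0Pr => e e0.
  rewrite ler_pdivrMl//; apply: infle; rewrite vl_scale_le// scalerA.
  rewrite mulKf ?lt0r_neq0//.
  by apply: ltinf; rewrite ltrDl.
- by split; apply: infle; rewrite ?scale1r// scaleN1r.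
Qed.

(** A homomorphism below the functional that [sup_sublinear_below] gives for
    [vabs x] attains the supremum of [vabs x]. *)
Lemma unital_hom_norm_attained x :
  exists2 f, unital_hom f & `|f x| = unit_norm u x.
Proof.
have sp := sup_sublinear_upper_bound; pose y := vabs x.
have [q [sq qp qy]] := sup_sublinear_below y sp.
have [f hf fq] := unital_hom_below sq; exists f => //.
have fN z := unital_homN z hf.
have -> : `|f x| = f y by exact/esym/unital_hom_vabs.
have -> : unit_norm u x = upper_bound_unit y.
  congr inf; apply/seteqP; split=> l /= => [[]//|xl]; split=> //.
  by apply: unit_le_scale; rewrite scale0r (le_trans _ xl)// vabs_ge0.
apply/eqP; rewrite eq_le (le_trans (fq y) (qp y))/= -lerN2 -fN.
exact: le_trans (fq _) qy.
Qed.

End LatticeHomomorphisms.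

(** * Continuous functions on compact spaces *)

Lemma closed_equalizer (R : realType) (T : topologicalType) (g h : T -> R) :
  continuous g -> continuous h -> closed [set t | g t = h t].
Proof.
move=> gc hc.
have -> : [set t | g t = h t] = (fun t => g t - h t) @^-1` [set x | x = 0].
  by apply/seteqP; split=> t /= => [->|/subr0_eq//]; rewrite subrr.
apply: (continuous_closedP (fun t => g t - h t)).1; last exact: closed_eq.
by move=> t; apply: (@cvgB _ R); [exact: gc|exact: hc].
Qed.

Lemma continuous_scaleD (R : realType) (T : topologicalType) (a : R)
    (g h : T -> R) :
  continuous g -> continuous h -> continuous (fun t => a * g t + h t).
Proof.
move=> gc hc t; apply: (@cvgD _ R); last exact: hc.
by apply: (@cvgM R); [exact: cvg_cst|exact: gc].
Qed.

Lemma continuous_addr (R : realType) (T : topologicalType) (g : T -> R)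
    (c : R) :
  continuous g -> continuous (fun t => g t + c).
Proof. by move=> gc t; apply: (@cvgD _ R); [exact: gc|exact: cvg_cst]. Qed.

Lemma open_ltfun (R : realType) (T : topologicalType) (g h : T -> R) :
  continuous g -> continuous h -> open [set t | g t < h t].
Proof.
move=> gc hc.
have -> : [set t | g t < h t] = (fun t => h t - g t) @^-1` [set x | 0 < x].
  by apply/seteqP; split=> t /=; rewrite subr_gt0.
apply: (continuousP (fun t => h t - g t)).1; last exact: open_gt.
by move=> t; apply: (@cvgB _ R); [exact: hc|exact: gc].
Qed.

(** Otherwise the complements generate a proper filter, and no cluster point of
    it is covered. *)
Lemma compact_directed_cover (T : topologicalType) (I : Type) (D : set I)
    (O : I -> set T) : compact [set: T] ->
  (forall i, D i -> open (O i)) -> D !=set0 ->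
  (forall i j, D i -> D j -> exists2 k, D k & O i `<=` O k /\ O j `<=` O k) ->
  (forall t, exists2 i, D i & O i t) ->
  exists2 i, D i & forall t, O i t.
Proof.
move=> cT oO D0 dirO cov; apply: contrapT => ncov.
pose F := filter_from D (fun i => ~` O i).
have FF : ProperFilter F.
  apply: filter_from_proper; last first.
    move=> i Di; apply: contrapT => h; apply: ncov; exists i => // t.
    by apply: contrapT => Ot; apply: h; exists t.
  apply: filter_from_filter => // i j Di Dj.
  have [k Dk [ik jk]] := dirO i j Di Dj.
  by exists k => // t Ot; split=> [/ik|/jk].
have [p [_ clp]] := cT F FF filterT.
have [i Di Oip] := cov p.
have nO : nbhs p (O i) by apply: open_nbhs_nbhs; split; first exact: oO.
have [|t [nOt Ot]] := clp (~` O i) (O i) _ nO.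
  by exists i.
exact: nOt.
Qed.

(** * Representation on the space of unital homomorphisms *)

Section Spectrum.
Variables (R : realType) (X : vectorLatticeType R) (u : X).
Hypothesis su : strong_unit u.
Implicit Types (x y z : X) (f : X -> R).

Lemma unital_hom_mono f x y : unital_hom u f -> x <= y -> f x <= f y.
Proof.
by move=> [_ fm _]; rewrite -vsup_idr => /eqP <-; rewrite fm le_max lexx.
Qed.

Lemma unital_homZ f (a : R) x : unital_hom u f -> f (a *: x) = a * f x.
Proof.
move=> hf; have [fl _ _] := hf; have := fl a x 0; rewrite addr0 => ->.
have /eqP := unital_homN 0 hf.
rewrite oppr0 -subr_eq0 opprK -mulr2n mulrn_eq0/=.
by move=> /eqP ->; rewrite addr0.
Qed.

Lemma unital_hom_le_norm f x : unital_hom u f -> `|f x| <= unit_norm u x.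
Proof.
move=> hf; apply/ler_addgt0Pr => e e0.
rewrite -(unital_hom_vabs x hf); have [_ _ fu] := hf.
rewrite -[leRHS]mulr1 -fu -unital_homZ//; apply: unital_hom_mono => //.
by apply: unit_norm_lt; rewrite ?ltrDl.
Qed.

Definition unital_homs :
    set (prod_topology (fun _ : X => (R : topologicalType))) :=
  [set f | unital_hom u f].

Definition spectrum : topologicalType := set_type unital_homs.

Definition eval x (k : spectrum) : R := set_val k x.

Lemma spectrumP (k : spectrum) : unital_hom u (eval^~ k).
Proof. exact: set_valP k. Qed.

Definition to_spectrum f (hf : unital_hom u f) : spectrum :=
  exist _ (f : prod_topology _) (mem_set (hf : unital_homs f)).

Lemma eval_continuous x : continuous (eval x).
Proof.
move=> k.
pose P := prod_topology (fun _ : X => (R : topologicalType)).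
apply: (@continuous_comp spectrum P R set_val (fun f : P => f x)).
  exact: initial_continuous.
exact: proj_continuous.
Qed.

Lemma spectrum_hausdorff : hausdorff_space spectrum.
Proof.
move=> k l kl; apply: val_inj; apply/funext => x.
apply: (@Rhausdorff R) => A B /= Ak Bl.
have [m [Am Bm]] :=
  kl _ _ (@eval_continuous x k _ Ak) (@eval_continuous x l _ Bl).
by exists (eval x m).
Qed.

Lemma closed_unital_homs : closed unital_homs.
Proof.
pose P := prod_topology (fun _ : X => (R : topologicalType)).
have pc x : continuous (fun f : P => f x).
  exact: proj_continuous.
have -> : unital_homs =
    (\bigcap_(a in setT) \bigcap_(x in setT) \bigcap_(y in setT)
       [set f | f (a *: x + y) = a * f x + f y]) `&`
    (\bigcap_(x in setT) \bigcap_(y in setT)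
       [set f | f (vsup x y) = Num.max (f x) (f y)]) `&`
    [set f | f u = 1].
  apply/seteqP; split=> [f [fl fm fu]|f [[fl fm] fu]].
    by split=> //; split=> [a _ x _ y _|x _ y _]; [exact: fl|exact: fm].
  by split=> // *; [exact: fl|exact: fm].
apply: closedI; first apply: closedI.
- do 3 apply: closed_bigI => ? _; apply: closed_equalizer; first exact: pc.
  by apply: continuous_scaleD; exact: pc.
- do 2 apply: closed_bigI => ? _; apply: closed_equalizer; first exact: pc.
  by move=> f; apply: (@continuous_max R); exact: pc.
- apply: closed_equalizer; [exact: pc|exact: cst_continuous].
Qed.

(** A homomorphism maps [x] into the interval of radius [unit_norm u x], so the
    homomorphisms form a closed subset of a product of compact intervals. *)
Lemma spectrum_compact : compact [set: spectrum].
Proof.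
have cU : compact unital_homs.
  apply: subclosed_compact closed_unital_homs
    (@tychonoff X _ (fun x => [set` `[- unit_norm u x, unit_norm u x]]) _) _.
    by move=> x; exact: segment_compact.
  by move=> f hf x; rewrite /= in_itv/= -ler_norml unital_hom_le_norm.
move=> F FF _.
pose v (k : spectrum) : prod_topology (fun _ : X => (R : topologicalType)) :=
  set_val k.
have [|p [Up clp]] := cU (v @ F) _.
  rewrite /fmap/=; apply: (@filterE _ F) => k; exact: (set_valP k).
exists (to_spectrum Up); split=> // A B FA [_ [[C Co <-]] /= Cp CB].
have [||q [[k Ak <-] Ck]] := clp (v @` A) C _ _.
- by rewrite /fmap/=; apply: (@filterS _ F) FA => k Ak; exists k.
- by apply: open_nbhs_nbhs; split.
by exists k; split=> //; exact: CB.
Qed.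

Lemma unital_hom_vinf f x y :
  unital_hom u f -> f (vinf x y) = Num.min (f x) (f y).
Proof.
by move=> hf; have [_ fm _] := hf;
  rewrite vinf_vsup (unital_homN _ hf) fm !(unital_homN _ hf) oppr_max !opprK.
Qed.

Lemma eval_linear (a : R) x y k : eval (a *: x + y) k = a * eval x k + eval y k.
Proof. by have [kl _ _] := spectrumP k; exact: kl. Qed.

Lemma evalZ (a : R) x k : eval (a *: x) k = a * eval x k.
Proof. exact: unital_homZ (spectrumP k). Qed.

Lemma evalB x y k : eval (x - y) k = eval x k - eval y k.
Proof. by rewrite addrC -scaleN1r eval_linear mulN1r addrC. Qed.

Lemma eval_vsup x y k : eval (vsup x y) k = Num.max (eval x k) (eval y k).
Proof. by have [_ km _] := spectrumP k; exact: km. Qed.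

Lemma eval_vinf x y k : eval (vinf x y) k = Num.min (eval x k) (eval y k).
Proof. exact: unital_hom_vinf (spectrumP k). Qed.

Lemma eval_unit k : eval u k = 1.
Proof. by have [_ _] := spectrumP k. Qed.

Lemma eval_le_norm x k : `|eval x k| <= unit_norm u x.
Proof. exact: unital_hom_le_norm (spectrumP k). Qed.

(** The second case is that of [X = 0], which has no unital homomorphism. *)
Lemma spectrum_norm_attained x :
  (exists k : spectrum, `|eval x k| = unit_norm u x) \/
  (unit_norm u x = 0 /\ ~ exists k : spectrum, True).
Proof.
have [x0|x0] := eqVneq x 0.
  have [[k _]|] := pselect (exists k : spectrum, True); [left|right].
    exists k; rewrite x0 -(scale0r (0 : X)) evalZ unit_normZ// normr0.
    by rewrite !mul0r normr0.
  by split=> //; rewrite x0 -(scale0r (0 : X)) unit_normZ// normr0 mul0r.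
have un0 : u != 0.
  apply: contra_neq x0 => u0; apply: vabs_le0.
  by have [_ /(_ x)[k _]] := (strong_unitP u).1 su; rewrite u0 scaler0.
have [f hf fx] := unital_hom_norm_attained su un0 x.
by left; exists (to_spectrum hf).
Qed.

(** Distinct homomorphisms differ at some [z], and a combination of [z] and [u]
    interpolates. *)
Lemma spectrum_two_points (f : spectrum -> R) (k l : spectrum) :
  exists x, eval x k = f k /\ eval x l = f l.
Proof.
have [->|kl] := pselect (k = l).
  by exists (f l *: u); rewrite evalZ eval_unit mulr1.
have [z zkl] : exists z, eval z k != eval z l.
  apply: contrapT => h; apply: kl; apply: val_inj; apply/funext => z.
  by apply/eqP; apply: contrapT => /negP zkl; apply: h; exists z.
have d0 : eval z k - eval z l != 0 by rewrite subr_eq0.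
pose a := (f k - f l) / (eval z k - eval z l).
exists (a *: z + (f k - a * eval z k) *: u).
rewrite !eval_linear !evalZ !eval_unit !mulr1.
split; first by rewrite addrC subrK.
have e : a * (eval z k - eval z l) = f k - f l by rewrite divfK.
by rewrite addrCA -mulrBr -(opprB (eval z k)) mulrN e subKr.
Qed.

(** The Stone-Weierstrass theorem for lattices. For fixed [k] the elements that
    agree with [f] at [k] are directed downwards, and compactness gives one of
    them below [f + e]. The elements below [f + e] are directed upwards, and
    compactness gives one of them above [f - e]. *)
Lemma spectrum_dense (f : spectrum -> R) (e : R) : continuous f -> 0 < e ->
  exists x, forall k, `|eval x k - f k| < e.
Proof.
move=> fc e0.
have [[k0 _]|nk] := pselect (exists k : spectrum, True); last first.
  by exists 0 => k; exfalso; apply: nk; exists k.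
have fDc c : continuous (fun k => f k + c).
  by apply: continuous_addr.
have below k : exists2 x, eval x k = f k & forall l, eval x l < f l + e.
  have [||x y|l|x xk xO] := @compact_directed_cover _ X [set x | eval x k = f k]
    (fun x => [set l | eval x l < f l + e]) spectrum_compact.
  - by move=> x _; apply: open_ltfun; [exact: eval_continuous|exact: fDc].
  - by have [x [xk _]] := spectrum_two_points f k k; exists x.
  - move=> /= xk yk; exists (vinf x y).
      by rewrite /= eval_vinf xk yk minxx.
    by split=> l /= h; rewrite eval_vinf gt_min h ?orbT.
  - have [x [xk xl]] := spectrum_two_points f k l; exists x => //=.
    by rewrite xl ltrDl.
  - by exists x.
have [||x y|l|x xlt xgt] := @compact_directed_cover _ X
    [set x | forall l, eval x l < f l + e]
    (fun x => [set l | f l + - e < eval x l]) spectrum_compact.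
- by move=> x _; apply: open_ltfun; [exact: fDc|exact: eval_continuous].
- by have [x _ xO] := below k0; exists x.
- move=> /= xe ye; exists (vsup x y).
    by move=> l /=; rewrite eval_vsup gt_max xe ye.
  by split=> l /= h; rewrite eval_vsup lt_max h ?orbT.
- by have [x xl xO] := below l; exists x => //=; rewrite xl gtrDl oppr_lt0.
- by exists x => k; rewrite ltr_distl xlt xgt.
Qed.

(** Kakutani's representation theorem. Evaluation on the spectrum preserves the
    norm by [spectrum_norm_attained]. Its range is dense by [spectrum_dense],
    and is closed because the norm is complete. *)
Theorem unit_norm_isometric_CK : (forall x, unit_norm u x = 0 -> x = 0) ->
  norm_complete (unit_norm u) -> lattice_isometric_to_CK (unit_norm u).
Proof.
move=> N0 cN.
pose T x : continuousType spectrum R := mkcts (@eval_continuous x).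
have Tinj : injective T.
  move=> x y Txy; apply/subr0_eq/N0.
  have [[k <-]|[]//] := spectrum_norm_attained (x - y).
  have exy : eval x k = eval y k.
    exact: (congr1 (fun g : continuousType spectrum R => g k) Txy).
  by rewrite evalB exy subrr normr0.
have Tsurj (f : continuousType spectrum R) : exists x, T x = f.
  have /choice[x xf] : forall n : nat,
      exists x, forall k, `|eval x k - f k| < n.+1%:R^-1.
    by move=> n; apply: spectrum_dense; [exact: cts_fun|rewrite invr_gt0].
  have dist m n (e : R) : m.+1%:R^-1 < e / 2 -> n.+1%:R^-1 < e / 2 ->
      unit_norm u (x m - x n) < e.
    move=> me ne.
    have [[k <-]|[-> _]] := spectrum_norm_attained (x m - x n); last first.
      have : 0 < e / 2 by apply: lt_trans me; rewrite invr_gt0.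
      by rewrite pmulr_lgt0// invr_gt0.
    rewrite evalB [e]splitr -(subrKA (f k)).
    apply: le_lt_trans (ler_normD _ _) _.
    rewrite [X in _ + X]distrC; apply: ltrD; first exact: lt_trans (xf m k) me.
    exact: lt_trans (xf n k) ne.
  have small (e : R) : 0 < e ->
      exists N, forall n, (N <= n)%N -> n.+1%:R^-1 < e.
    by move=> e0; have [N _ hN] := near_infty_natSinv_lt (PosNum e0); exists N.
  have [|y xy] := cN x.
    move=> e e0; have [N hN] := small (e / 2) (divr_gt0 e0 (ltr0Sn _ 1)).
    by exists N => m n Nm Nn; apply: dist; exact: hN.
  exists y; apply/continuousEP => k; apply/eqP; rewrite -subr_eq0 -normr_le0.
  apply/ler_addgt0Pr => e e0; rewrite add0r.
  have e20 : 0 < e / 2 by rewrite divr_gt0.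
  have [N hN] := small _ e20.
  have /cvgrPdist_lt/(_ _ e20)[M _ hM] := xy.
  pose n := maxn N M.
  rewrite -(subrKA (eval (x n) k)); apply: le_trans (ler_normD _ _) _.
  rewrite [e]splitr; apply: lerD; last first.
    exact/ltW/(lt_trans (xf n k))/hN/leq_maxl.
  rewrite -evalB; apply: le_trans (eval_le_norm _ k) _.
  have := hM n (leq_maxr _ _).
  rewrite /= sub0r normrN ger0_norm ?unit_norm_ge0//.
  by rewrite unit_norm_dist// => /ltW.
exists spectrum, T; split.
- exact: spectrum_compact.
- exact: spectrum_hausdorff.
- split.
  + have [g gT] := choice Tsurj; exists g => // x; apply: Tinj; exact: gT.
  + by move=> a x y k; exact: eval_linear.
  + by move=> x y k; exact: eval_vsup.
  + by move=> x y k; exact: eval_vinf.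
  + move=> x; rewrite /sup_norm; set A := [set _ | _ in _].
    have ubA : ubound A (unit_norm u x).
      by move=> _ [k _ <-]; exact: eval_le_norm.
    have [[k kx]|[-> nk]] := spectrum_norm_attained x; last first.
      have -> : A = set0.
        by apply/seteqP; split=> // t [k _ tE]; apply: nk; exists k.
      exact: sup0.
    apply/eqP; rewrite eq_le; apply/andP; split.
      by apply: ge_sup => //; exists `|eval x k|; exists k.
    by apply: ub_le_sup; [exists (unit_norm u x)|exists k].
Qed.

End Spectrum.

(** * The equivalence *)

Theorem theorem5p1 (R : realType) (X Xh : locallySolidType R)
    (i : {linear X -> Xh}) (archX : archimedean X) (hausX : hausdorff_space X)
    (hXh : is_completion i) :
  [<-> locally_bounded (unbounded X);
       has_order_bounded_nbhs (unbounded X);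
       has_order_bounded_nbhs X;
       (exists u : Xh, strong_unit u) /\ metrizable R X;
       exists u : Xh, [/\ strong_unit u,
         forall x : Xh, nbhs x = nbhs_ball_ (ball_ (unit_norm u)) x,
         banach_lattice (unit_norm u) &
         lattice_isometric_to_CK (unit_norm u)];
       locally_bounded (unbounded Xh)]
  /\ (locally_bounded (unbounded X) ->
      (forall x : X, nbhs x = unbounded_nbhs (x : unbounded X)) /\
      (forall x : Xh, nbhs x = unbounded_nbhs (x : unbounded Xh))).
Proof.
have hausXh := completion_hausdorff hXh.
have interval (Y : locallySolidType R) : hausdorff_space Y ->
    locally_bounded (unbounded Y) ->
    exists2 w : Y, 0 <= w & nbhs (0 : Y) (sym_interval w).
  move=> hY /(locally_bounded_unbounded_interval hY)[w w0 nw].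
  by exists w => //; exact: nbhs_unbounded.
split.
- tfae.
  + move=> /(locally_bounded_unbounded_interval hausX) h.
    exact/has_order_bounded_nbhsP.
  + by move=> [U U0 bU]; exists U => //; exact: nbhs_unbounded.
  + move=> /has_order_bounded_nbhsP[w w0 nw]; split; last first.
      exact: nbhs_interval_metrizable nw hausX.
    exists (i w); apply: nbhs_interval_strong_unit.
      by rewrite -(linear0 i) (completion_le hXh).
    exact: completion_nbhs_interval.
  + move=> [[u su] mX]; exists u.
    have nu := strong_unit_nbhs_interval hXh mX su.
    have [u0 _] := (strong_unitP u).1 su.
    have cN := unit_norm_complete u0 nu (completion_complete hXh).
    split=> //.
    * exact: nbhs_unit_norm_ball.
    * by split=> //; exact: unit_norm_lattice_norm.
    * by apply: unit_norm_isometric_CK => // x; exact: unit_norm_eq0.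
  + move=> [u [su nE _ _]]; have [u0 _] := (strong_unitP u).1 su.
    apply: (nbhs_interval_locally_bounded u0).
    exact: ball_unit_norm_nbhs_interval.
  + move=> /(interval _ hausXh)[w w0 nw].
    have [x x0 nx] := completion_nbhs_interval_inv hXh w0 nw.
    exact: nbhs_interval_locally_bounded nx.
- move=> /(interval _ hausX)[w w0 nw]; split.
    exact: nbhs_interval_unbounded nw.
  apply: (@nbhs_interval_unbounded _ _ (i w)).
    by rewrite -(linear0 i) (completion_le hXh).
  exact: completion_nbhs_interval.
Qed.
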